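(* Let $\mathbb{K}$ be an algebraically closed field of characteristic zero, $m$ a strictly positive integer, $\mathfrak{a}=\mathfrak{gl}(m,\mathbb{K})$, $\mathfrak{n}=\mathbb{K}^m$ (an abelian Lie algebra), and let $\mathfrak{g}=\mathfrak{a}\oplus\mathfrak{n}$ be the semidirect sum with bracket $[\phi+v,\phi'+v']=[\phi,\phi']+\phi v'-\phi'v$ for $\phi,\phi'\in\mathfrak{a}$, $v,v'\in\mathfrak{n}$. Then $$\mathbf{H}^0_{CE}(\mathfrak{n},\mathcal{S}\mathfrak{g})^{\mathfrak{a}}\cong\mathbb{K}\quad\text{and}\quad \mathbf{H}^k_{CE}(\mathfrak{n},\mathcal{S}\mathfrak{g})^{\mathfrak{a}}\cong\{0\}\ \text{ for all integers } k\ge1.$$ Consequently, for every $k\in\mathbb{N}$, $$\mathbf{H}^k_{CE}(\mathfrak{g},\mathcal{S}\mathfrak{g})\cong\mathbf{H}^k_{CE}(\mathfrak{a},\mathbb{K}).$$ In particular $\mathbf{H}^2_{CE}(\mathfrak{g},\mathcal{S}\mathfrak{g})\cong\{0\}$, so $\mathfrak{g}$ is infinitesimally strongly rigid.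
   Context: $\mathbf{H}_{CE}$ denotes Chevalley–Eilenberg cohomology. $\mathcal{S}\mathfrak{g}$ is the symmetric algebra of $\mathfrak{g}$, a $\mathfrak{g}$-module by the extension of the adjoint action by derivations, and an $\mathfrak{n}$-module by restriction. The superscript $\mathfrak{a}$ denotes the subspace of elements invariant under the natural action of $\mathfrak{a}$ on the cohomology. $\mathbb{K}$ is the trivial module. A Lie algebra $\mathfrak{g}$ is infinitesimally strongly rigid if $\mathbf{H}^2_{CE}(\mathfrak{g},\mathcal{S}\mathfrak{g})=\{0\}$. *)

(* Defs.v *)
From HB Require Import structures.
From mathcomp Require Import all_boot all_order all_algebra.
From mathcomp Require Import boolp functions.
From mathcomp Require Import mpoly.
From mathcomp Require Import ring.
Set Implicit Arguments. Unset Strict Implicit. Unset Printing Implicit Defensive.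
Import GRing.Theory.
Local Open Scope ring_scope.
Local Open Scope quotient_scope.

Definition lmod_iso (K : fieldType) (U V : lmodType K) : Prop :=
  exists f : {linear U -> V}, bijective f.

Definition lmod_trivial (K : fieldType) (U : lmodType K) : Prop :=
  forall u : U, u = 0.

Section LmodQuotient.
Variables (K : fieldType) (V : lmodType K) (B : submodClosed V).

Definition submod_pred : {pred V} := B.
Fact submod_pred_zmod : zmod_closed submod_pred.
Proof. by split=> [|x y xB yB]; rewrite ?rpred0 // -scaleN1r rpredD ?rpredZ. Qed.
HB.instance Definition _ := GRing.isZmodClosed.Build V submod_pred submod_pred_zmod.

Definition lmod_quot : Type := Quotient.quot submod_pred.
HB.instance Definition _ := GRing.Zmodule.on lmod_quot.
HB.instance Definition _ := EqQuotient.on lmod_quot.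

Lemma pi_lmod_eq (x y : V) : (\pi_lmod_quot x == \pi_lmod_quot y) = (x - y \in B).
Proof. exact/esym/(@Quotient.idealrBE _ submod_pred). Qed.

Lemma pi_lmodD : {morph \pi_lmod_quot : x y / x + y}.
Proof. by move=> x y; exact: Quotient.pi_add. Qed.

Definition lmod_quot_scale (a : K) (q : lmod_quot) : lmod_quot :=
  \pi_lmod_quot (a *: repr q).

Lemma pi_lmodZ (a : K) (x : V) :
  lmod_quot_scale a (\pi_lmod_quot x) = \pi_lmod_quot (a *: x).
Proof.
apply/eqP; rewrite /lmod_quot_scale pi_lmod_eq -scalerBr rpredZ //.
by rewrite -pi_lmod_eq reprK.
Qed.

Lemma lmod_quot_scaleA a b q :
  lmod_quot_scale a (lmod_quot_scale b q) = lmod_quot_scale (a * b) q.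
Proof. by rewrite -[q]reprK (pi_lmodZ b) !pi_lmodZ scalerA. Qed.

Lemma lmod_quot_scale1 : left_id 1 lmod_quot_scale.
Proof. by move=> q; rewrite -[q]reprK pi_lmodZ scale1r. Qed.

Lemma lmod_quot_scaleDr : right_distributive lmod_quot_scale +%R.
Proof.
move=> a p q; rewrite -[p]reprK -[q]reprK.
by rewrite -pi_lmodD !pi_lmodZ scalerDr pi_lmodD.
Qed.

Lemma lmod_quot_scaleDl q : {morph lmod_quot_scale^~ q : a b / a + b}.
Proof. by move=> a b; rewrite -[q]reprK !pi_lmodZ scalerDl pi_lmodD. Qed.

HB.instance Definition _ := GRing.Zmodule_isLmodule.Build K lmod_quot
  lmod_quot_scaleA lmod_quot_scale1 lmod_quot_scaleDr lmod_quot_scaleDl.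

Lemma pi_lmod_linear : linear (\pi_lmod_quot : V -> lmod_quot).
Proof. by move=> a x y; rewrite pi_lmodD -pi_lmodZ. Qed.

End LmodQuotient.

HB.mixin Record isLieAlgebra (K : fieldType) L of Vector K L := {
  lie : L -> L -> L;
  lie_linearl : forall y : L, linear (lie^~ y);
  lie_linearr : forall x : L, linear (lie x);
  liexx : forall x : L, lie x x = 0;
  lie_jacobi : forall x y z : L,
    lie x (lie y z) + lie y (lie z x) + lie z (lie x y) = 0
}.

#[short(type="lieAlgType")]
HB.structure Definition LieAlgebra (K : fieldType) :=
  {L of isLieAlgebra K L & Vector K L}.

Section LieTheory.
Variables (K : fieldType) (L : lieAlgType K).
Implicit Types x y z : L.

Lemma lieDl x y z : lie (x + y) z = lie x z + lie y z.
Proof. by have := lie_linearl z 1 x y; rewrite !scale1r. Qed.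
Lemma lieDr x y z : lie x (y + z) = lie x y + lie x z.
Proof. by have := lie_linearr x 1 y z; rewrite !scale1r. Qed.
Lemma lie0x z : lie 0 z = 0.
Proof. by apply: (addrI (lie 0 z)); rewrite -lieDl !addr0. Qed.
Lemma liex0 z : lie z 0 = 0.
Proof. by apply: (addrI (lie z 0)); rewrite -lieDr !addr0. Qed.
Lemma lieZl a x z : lie (a *: x) z = a *: lie x z.
Proof. by have := lie_linearl z a x 0; rewrite lie0x !addr0. Qed.
Lemma lieZr a x z : lie x (a *: z) = a *: lie x z.
Proof. by have := lie_linearr x a z 0; rewrite liex0 !addr0. Qed.
Lemma lieC x y : lie y x = - lie x y.
Proof.
apply/eqP; rewrite -addr_eq0 addrC; apply/eqP.
by have := liexx (x + y); rewrite lieDl !lieDr !liexx add0r addr0.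
Qed.
Lemma lieNr x y : lie x (- y) = - lie x y.
Proof. by rewrite -scaleN1r lieZr scaleN1r. Qed.
Lemma lie_lie x y z : lie (lie x y) z = lie x (lie y z) - lie y (lie x z).
Proof.
apply/eqP; rewrite (lieC z) -subr_eq0 -opprD oppr_eq0.
by rewrite (lieC z x) lieNr opprK addrC (lie_jacobi x y z).
Qed.
Lemma lie_sumr x I (r : seq I) (P : pred I) (F : I -> L) :
  lie x (\sum_(i <- r | P i) F i) = \sum_(i <- r | P i) lie x (F i).
Proof. by apply: (big_morph (lie x)); [exact: lieDr | exact: liex0]. Qed.

End LieTheory.

Record lieHom (K : fieldType) (L1 L2 : lieAlgType K) := LieHom {
  lieHom_fun :> {linear L1 -> L2};
  lieHom_lie : forall x y, lieHom_fun (lie x y) = lie (lieHom_fun x) (lieHom_fun y)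
}.

Record lieRep (K : fieldType) (L : lieAlgType K) (M : lmodType K) := LieRep {
  lieRep_fun :> L -> M -> M;
  lieRep_linearl : forall m, linear (lieRep_fun^~ m);
  lieRep_linearr : forall x, linear (lieRep_fun x);
  lieRep_lie : forall x y m, lieRep_fun (lie x y) m =
    lieRep_fun x (lieRep_fun y m) - lieRep_fun y (lieRep_fun x m)
}.

Section LieRepConstructions.
Variables (K : fieldType) (L1 L2 : lieAlgType K) (M : lmodType K).

Section Restriction.
Variables (h : lieHom L1 L2) (rho : lieRep L2 M).
Definition lieRep_res_fun (x : L1) (m : M) : M := rho (h x) m.
Fact res_linearl m : linear (lieRep_res_fun^~ m).
Proof. by move=> a x y; rewrite /lieRep_res_fun linearP (lieRep_linearl rho). Qed.
Fact res_linearr x : linear (lieRep_res_fun x).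
Proof. exact: lieRep_linearr. Qed.
Fact res_lie x y m : lieRep_res_fun (lie x y) m =
  lieRep_res_fun x (lieRep_res_fun y m) - lieRep_res_fun y (lieRep_res_fun x m).
Proof. by rewrite /lieRep_res_fun lieHom_lie lieRep_lie. Qed.
Definition lieRep_res : lieRep L1 M := LieRep res_linearl res_linearr res_lie.
End Restriction.

Section Trivial.
Definition lieRep_trivial_fun (x : L1) (m : M) : M := 0.
Fact triv_linearl m : linear (lieRep_trivial_fun^~ m).
Proof. by move=> a x y; rewrite /lieRep_trivial_fun scaler0 addr0. Qed.
Fact triv_linearr x : linear (lieRep_trivial_fun x).
Proof. by move=> a m p; rewrite /lieRep_trivial_fun scaler0 addr0. Qed.
Fact triv_lie x y m : lieRep_trivial_fun (lie x y) m =
  lieRep_trivial_fun x (lieRep_trivial_fun y m)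
  - lieRep_trivial_fun y (lieRep_trivial_fun x m).
Proof. by rewrite /lieRep_trivial_fun subr0. Qed.
Definition lieRep_trivial : lieRep L1 M :=
  LieRep triv_linearl triv_linearr triv_lie.
End Trivial.

End LieRepConstructions.

(* The symmetric algebra of a finite dimensional vector space, realised as the
   polynomial ring on its basis [vbasis fullv]; [sym_universal] is its universal
   property. *)
Section SymmetricAlgebra.
Variables (K : fieldType) (V : vectType K).

Definition sym_alg : comAlgType K := {mpoly K[\dim {:V}]}.

Definition sym_inj (v : V) : sym_alg :=
  \sum_(i < \dim {:V}) coord (vbasis fullv) i v *: ('X_i : {mpoly K[\dim {:V}]}).

Lemma sym_inj_linear : linear sym_inj.
Proof.
move=> a u v; rewrite /sym_inj scaler_sumr -big_split /=.
by apply: eq_bigr => i _; rewrite linearP scalerDl scalerA.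
Qed.
HB.instance Definition _ :=
  GRing.isLinear.Build K V sym_alg *:%R sym_inj sym_inj_linear.

Lemma sym_inj_basis (i : 'I_(\dim {:V})) : sym_inj (vbasis fullv)`_i = 'X_i.
Proof.
have fr : free (vbasis {:V}) by exact: basis_free (vbasisP _).
rewrite /sym_inj (bigD1 i) //= coord_free // eqxx scale1r big1 ?addr0 // => j nji.
by rewrite coord_free // eq_sym (negbTE nji) scale0r.
Qed.

Lemma sym_ind (P : sym_alg -> Prop) :
  (forall c : K, P (c%:A)) -> (forall v, P (sym_inj v)) ->
  (forall p q, P p -> P q -> P (p + q)) -> (forall p q, P p -> P q -> P (p * q)) ->
  forall p, P p.
Proof.
move=> PC Pi PD PM; apply: mpolyind => [|c m p _ _ Pp].
  by have := PC 0; rewrite scale0r.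
apply: (PD) Pp; rewrite -mulr_algl; apply: (PM) => //.
rewrite mpolyXE_id; elim/big_ind: _ => // [|i _]; first by have := PC 1; rewrite scale1r.
elim: (m i) => [|e IH]; first by rewrite expr0; have := PC 1; rewrite scale1r.
by rewrite exprS; apply: PM => //; rewrite -sym_inj_basis.
Qed.

Theorem sym_universal (A : comAlgType K) (f : {linear V -> A}) :
  exists2 F : {lrmorphism sym_alg -> A}, (forall v, F (sym_inj v) = f v) &
    forall G : {lrmorphism sym_alg -> A}, (forall v, G (sym_inj v) = f v) -> G =1 F.
Proof.
pose F0 : sym_alg -> A :=
  mmap (in_alg A) (fun i : 'I_(\dim {:V}) => f (vbasis fullv)`_i).
have F0_lin : linear F0 by move=> a p q; rewrite /F0 mmapD mmapZ mulr_algl.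
have F0_mul : monoid_morphism F0.
  by split; rewrite /F0; [exact: rmorph1 | exact: rmorphM].
pose bL := GRing.isLinear.Build K sym_alg A *:%R F0 F0_lin.
pose bM := GRing.isMonoidMorphism.Build sym_alg A F0 F0_mul.
pose F : {lrmorphism sym_alg -> A} := HB.pack F0 bL bM.
have FE v : F (sym_inj v) = f v.
  rewrite /sym_inj linear_sum /= [v in RHS](coord_vbasis (memvf v)) linear_sum.
  apply: eq_bigr => i _.
  by rewrite [RHS]linearZ /F0 mmapZ mmapX mmap1U /= mulr_algl.
clearbody F; exists F => // G GE; apply: sym_ind => [c|v|p q Gp Gq|p q Gp Gq].
- by rewrite !rmorph_alg.
- by rewrite GE FE.
- by rewrite !linearD /= Gp Gq.
- by rewrite !rmorphM /= Gp Gq.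
Qed.

End SymmetricAlgebra.

Section SymmetricModule.
Variables (K : fieldType) (L : lieAlgType K).

(* [sym_act x] is the derivation of the symmetric algebra that extends
   [lie x]; see [sym_actM] and [sym_act_inj]. *)
Definition sym_act (x : L) (p : sym_alg L) : sym_alg L :=
  \sum_(i < \dim {:L}) mderiv i p * sym_inj (lie x (vbasis fullv)`_i).

Lemma sym_act_linearl p : linear (sym_act^~ p).
Proof.
move=> a x y; rewrite /sym_act scaler_sumr -big_split /=.
by apply: eq_bigr => i _; rewrite lieDl lieZl linearP mulrDr scalerAr.
Qed.

Lemma sym_act_linearr x : linear (sym_act x).
Proof.
move=> a p q; rewrite /sym_act scaler_sumr -big_split /=.
by apply: eq_bigr => i _; rewrite linearP mulrDl scalerAl.
Qed.
HB.instance Definition _ x :=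
  GRing.isLinear.Build K (sym_alg L) (sym_alg L) *:%R (sym_act x) (sym_act_linearr x).

Lemma sym_actD x p q : sym_act x (p + q) = sym_act x p + sym_act x q.
Proof. exact: linearD. Qed.

Lemma sym_actM x p q : sym_act x (p * q) = sym_act x p * q + p * sym_act x q.
Proof.
rewrite /sym_act mulr_suml mulr_sumr -big_split /=.
by apply: eq_bigr => i _; rewrite mderivM mulrDl mulrAC mulrA.
Qed.

Lemma sym_actA x (c : K) : sym_act x c%:A = 0.
Proof.
rewrite linearZ /= /sym_act big1 ?scaler0 // => i _.
by rewrite -mpolyC1 mderivC mul0r.
Qed.

Lemma sym_act_inj x y : sym_act x (sym_inj y) = sym_inj (lie x y).
Proof.
rewrite [y in RHS](coord_vbasis (memvf y)) lie_sumr !linear_sum.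
apply: eq_bigr => i _ /=; rewrite lieZr !linearZ /=; congr (_ *: _).
rewrite /sym_act (bigD1 i) //= mderivX mnm1E eqxx -[X in (X - _)%MM]add0m addmK.
rewrite mpolyX0 scale1r mul1r.
rewrite big1 ?addr0 // => j nji; rewrite mderivX mnm1E.
by rewrite eq_sym (negbTE nji) scale0r mul0r.
Qed.

Lemma sym_act_lie x y p :
  sym_act (lie x y) p = sym_act x (sym_act y p) - sym_act y (sym_act x p).
Proof.
elim/sym_ind: p => [c|v|p q Hp Hq|p q Hp Hq].
- by rewrite !sym_actA (linear0 (sym_act x)) (linear0 (sym_act y)) subr0.
- by rewrite !sym_act_inj lie_lie linearB.
- by rewrite !sym_actD Hp Hq opprD addrACA.
- by rewrite !sym_actM Hp Hq !sym_actD !sym_actM; ring.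
Qed.

Definition sym_rep : lieRep L (sym_alg L) :=
  LieRep sym_act_linearl sym_act_linearr sym_act_lie.

End SymmetricModule.

Section Cochains.
Variables (K : fieldType) (L : lieAlgType K) (M : lmodType K).

Definition upd k (v : 'I_k -> L) (i : 'I_k) (u : L) : 'I_k -> L :=
  fun j => if j == i then u else v j.

Definition alt_multilinear k (f : ('I_k -> L) -> M) : Prop :=
  (forall v i, linear (fun u => f (upd v i u))) /\
  (forall v i j, i != j -> v i = v j -> f v = 0).

Definition vcons k (u : L) (v : 'I_k -> L) : 'I_k.+1 -> L :=
  fun l => oapp v u (unlift ord0 l).

Variable rho : lieRep L M.

(* For i < j one has [lift j i = i] as natural numbers, and
   [fun p => v (lift j (lift i p))] is v with its i-th and j-th entries omitted. *)
Definition ce_diff_lie k : (('I_k -> L) -> M) -> ('I_k.+1 -> L) -> M :=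
  match k with
  | 0 => fun _ _ => 0
  | k'.+1 => fun f v =>
      \sum_(j < k'.+2) \sum_(i < k'.+1 | (i < j)%N) (-1) ^+ (i + j) *:
        f (vcons (lie (v (lift j i)) (v j)) (fun p => v (lift j (lift i p))))
  end.

Definition ce_diff k (f : ('I_k -> L) -> M) : ('I_k.+1 -> L) -> M := fun v =>
  \sum_(j < k.+1) (-1) ^+ j *: rho (v j) (f (fun p => v (lift j p)))
  + ce_diff_lie f v.

Lemma ce_diff_linear k : linear (@ce_diff k).
Proof.
move=> a f g; apply/funext => v.
rewrite -[RHS]/(a *: ce_diff f v + ce_diff g v) /ce_diff scalerDr addrACA scaler_sumr -big_split /=; congr (_ + _).
  by apply: eq_bigr => j _; rewrite lieRep_linearr scalerDr !scalerA mulrC.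
case: k f g v => [|k] f g v /=; first by rewrite scaler0 addr0.
rewrite scaler_sumr -big_split; apply: eq_bigr => j _ /=.
rewrite scaler_sumr -big_split; apply: eq_bigr => i _ /=.
by rewrite scalerDr !scalerA mulrC.
Qed.
HB.instance Definition _ k := GRing.isLinear.Build K (('I_k -> L) -> M)
  (('I_k.+1 -> L) -> M) *:%R (@ce_diff k) (@ce_diff_linear k).

Lemma alt_multilinear0 k : alt_multilinear (0 : ('I_k -> L) -> M).
Proof. by split=> // v i a x y; rewrite scaler0 addr0. Qed.

Lemma alt_multilinearP k a (f g : ('I_k -> L) -> M) :
  alt_multilinear f -> alt_multilinear g -> alt_multilinear (a *: f + g).
Proof.
move=> [fl fa] [gl ga]; split=> [v i b x y|v i j ij vij].
  rewrite addrfctE scalrfctE fl gl !scalerDr !scalerA (mulrC a b) -!addrA.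
  by congr (_ + _); rewrite addrCA.
by rewrite addrfctE scalrfctE (fa _ _ _ ij vij) (ga _ _ _ ij vij) scaler0 addr0.
Qed.

Definition is_cocycle k (f : ('I_k -> L) -> M) : Prop :=
  alt_multilinear f /\ ce_diff f = 0.

Definition is_coboundary k : (('I_k -> L) -> M) -> Prop :=
  match k with
  | 0 => fun f => f = 0
  | k'.+1 => fun f => exists2 g : ('I_k' -> L) -> M,
      alt_multilinear g & f = ce_diff g
  end.

Lemma is_coboundary0 k : is_coboundary (0 : ('I_k -> L) -> M).
Proof. by case: k => [|k] //=; exists 0; rewrite ?linear0 //; exact: alt_multilinear0. Qed.

Lemma is_coboundaryP k a (f g : ('I_k -> L) -> M) :
  is_coboundary f -> is_coboundary g -> is_coboundary (a *: f + g).
Proof.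
case: k f g => [|k] f g /=; first by move=> -> ->; rewrite scaler0 addr0.
move=> [f' f'P ->] [g' g'P ->]; exists (a *: f' + g'); last by rewrite linearP.
exact: alt_multilinearP.
Qed.

Section Degree.
Variable k : nat.

Definition cocycle_pred : {pred ('I_k -> L) -> M} := [pred f | `[< is_cocycle f >]].
Fact cocycle_pred_closed : submod_closed cocycle_pred.
Proof.
split=> [|a f g]; first by apply/asboolP; split; [exact: alt_multilinear0|rewrite linear0].
move=> /asboolP[fA df] /asboolP[gA dg]; apply/asboolP; split.
  exact: alt_multilinearP.
by rewrite linearP /= df dg scaler0 addr0.
Qed.
HB.instance Definition _ :=
  GRing.isSubmodClosed.Build K (('I_k -> L) -> M) cocycle_pred cocycle_pred_closed.

Record cocycle := Cocycle {
  cocycle_val :> ('I_k -> L) -> M;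
  cocycle_valP : cocycle_val \in cocycle_pred
}.
HB.instance Definition _ := [isSub for cocycle_val].
HB.instance Definition _ := [Choice of cocycle by <:].
HB.instance Definition _ := [SubChoice_isSubLmodule of cocycle by <:].

(* A cocycle is null when it is the differential of an alternating multilinear
   cochain, so that [coh] is Z^k / (B^k :&: Z^k); this is Z^k / B^k since
   [ce_diff] maps cochains to cocycles. *)
Definition coboundary_pred : {pred cocycle} :=
  [pred z | `[< is_coboundary (cocycle_val z) >]].
Fact coboundary_pred_closed : submod_closed coboundary_pred.
Proof.
split=> [|a f g]; first by apply/asboolP; exact: is_coboundary0.
by move=> /asboolP fB /asboolP gB; apply/asboolP; exact: is_coboundaryP.
Qed.
HB.instance Definition _ :=
  GRing.isSubmodClosed.Build K cocycle coboundary_pred coboundary_pred_closed.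

Definition coh : lmodType K := lmod_quot coboundary_pred.

End Degree.
End Cochains.

Arguments cocycle_pred {K L M} rho k _.
Arguments coboundary_pred {K L M} rho k _.

(* The data by which an element x of a Lie algebra g acts on the cochains of an
   ideal L of g with values in a g-module M: [eqv_L] is [x, -] restricted to L
   and [eqv_M] is the action of x on M. *)
Record equivariance (K : fieldType) (L : lieAlgType K) (M : lmodType K)
    (rho : lieRep L M) := Equivariance {
  eqv_L : {linear L -> L};
  eqv_M : {linear M -> M};
  eqv_lie : forall x y, eqv_L (lie x y) = lie (eqv_L x) y + lie x (eqv_L y);
  eqv_rep : forall x m, eqv_M (rho x m) = rho (eqv_L x) m + rho x (eqv_M m)
}.

Section CohomologyAction.
Variables (K : fieldType) (L : lieAlgType K) (M : lmodType K) (rho : lieRep L M).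
Variable D : equivariance rho.

Definition cochain_act k (f : ('I_k -> L) -> M) : ('I_k -> L) -> M := fun v =>
  eqv_M D (f v) - \sum_(i < k) f (upd v i (eqv_L D (v i))).

Lemma cochain_act_linear k : linear (@cochain_act k).
Proof.
move=> a f g; apply/funext => v.
rewrite -[RHS]/(a *: cochain_act f v + cochain_act g v) /cochain_act.
rewrite linearP big_split /= -scaler_sumr scalerBr opprD.
by rewrite addrACA.
Qed.
HB.instance Definition _ k := GRing.isLinear.Build K (('I_k -> L) -> M)
  (('I_k -> L) -> M) *:%R (@cochain_act k) (@cochain_act_linear k).

Lemma upd_same k (v : 'I_k -> L) i u : upd v i u i = u.
Proof. by rewrite /upd eqxx. Qed.
Lemma upd_other k (v : 'I_k -> L) i j u : j != i -> upd v i u j = v j.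
Proof. by rewrite /upd => /negbTE->. Qed.
Lemma upd_upd k (v : 'I_k -> L) i a b : upd (upd v i a) i b = upd v i b.
Proof. by apply/funext => l; rewrite /upd; case: eqP. Qed.
Lemma updC k (v : 'I_k -> L) i j a b : i != j ->
  upd (upd v i a) j b = upd (upd v j b) i a.
Proof.
move=> nij; apply/funext => l; rewrite /upd.
by have [->|//] := eqVneq l i; rewrite (negbTE nij).
Qed.
Lemma upd_id k (v : 'I_k -> L) i a : v i = a -> upd v i a = v.
Proof. by move=> <-; apply/funext => l; rewrite /upd; case: eqP => // ->. Qed.

Lemma altD k (f : ('I_k -> L) -> M) v i a b : alt_multilinear f ->
  f (upd v i (a + b)) = f (upd v i a) + f (upd v i b).
Proof. by case=> fl _; have := fl v i 1 a b; rewrite !scale1r. Qed.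

Lemma alt_swap k (f : ('I_k -> L) -> M) v i j a b : alt_multilinear f -> i != j ->
  f (upd (upd v i a) j b) + f (upd (upd v i b) j a) = 0.
Proof.
move=> fA nij; have f0 c : f (upd (upd v i c) j c) = 0.
  by apply: (fA.2 _ _ _ nij); rewrite upd_same upd_other // upd_same.
have := f0 (a + b); rewrite altD // !(updC _ _ _ nij) !altD //.
by rewrite -!(updC _ _ _ nij) !f0 add0r addr0 addrC.
Qed.

Lemma cochain_act_alt k (f : ('I_k -> L) -> M) :
  alt_multilinear f -> alt_multilinear (cochain_act f).
Proof.
move=> fA; split=> [v i c x y|v i j nij vij].
  have E u : cochain_act f (upd v i u) = eqv_M D (f (upd v i u)) -
      (f (upd v i (eqv_L D u)) +
       \sum_(l | l != i) f (upd (upd v l (eqv_L D (v l))) i u)).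
    rewrite /cochain_act (bigD1 i) //= upd_same upd_upd; congr (_ - (_ + _)).
    by apply: eq_bigr => l nli; rewrite upd_other // updC // eq_sym.
  have fl := fA.1; rewrite !E fl !linearP fl.
  have -> : \sum_(l | l != i) f (upd (upd v l (eqv_L D (v l))) i (c *: x + y)) =
     c *: \sum_(l | l != i) f (upd (upd v l (eqv_L D (v l))) i x) +
     \sum_(l | l != i) f (upd (upd v l (eqv_L D (v l))) i y).
    by rewrite scaler_sumr -big_split; apply: eq_bigr => l _; rewrite fl.
  by rewrite addrACA -scalerDr opprD addrACA -scalerBr.
rewrite /cochain_act (fA.2 _ _ _ nij vij) linear0 sub0r (bigD1 i) //=.
rewrite (bigD1 j) 1?eq_sym //= [X in _ + (_ + X)]big1 => [|l /andP[nli nlj]].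
  set w := v i; set a := eqv_L D w; rewrite -vij -/w -/a addr0.
  have -> : upd v i a = upd (upd v i a) j w.
    by apply/esym/upd_id; rewrite upd_other // eq_sym.
  have -> : upd v j a = upd (upd v i w) j a by rewrite [upd v i w]upd_id.
  by rewrite alt_swap // oppr0.
by apply: (fA.2 _ _ _ nij); rewrite !upd_other // eq_sym.
Qed.

Lemma upd_lift k (v : 'I_k.+1 -> L) j a :
  (fun p => upd v j a (lift j p)) = (fun p => v (lift j p)).
Proof. by apply/funext => p; rewrite upd_other // eq_sym neq_lift. Qed.

Lemma upd_liftr k (v : 'I_k.+1 -> L) j p a :
  (fun q => upd v (lift j p) a (lift j q)) = upd (fun q => v (lift j q)) p a.
Proof. by apply/funext => q; rewrite /upd (inj_eq lift_inj). Qed.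

Lemma vcons0 k u (v : 'I_k -> L) : vcons u v ord0 = u.
Proof. by rewrite /vcons unlift_none. Qed.
Lemma vconsS k u (v : 'I_k -> L) p : vcons u v (lift ord0 p) = v p.
Proof. by rewrite /vcons liftK. Qed.
Lemma upd_vcons0 k u (v : 'I_k -> L) a : upd (vcons u v) ord0 a = vcons a v.
Proof.
apply/funext => l; case: (unliftP ord0 l) => [p|] ->; last by rewrite upd_same vcons0.
by rewrite upd_other ?vconsS // eq_sym neq_lift.
Qed.
Lemma upd_vconsS k u (v : 'I_k -> L) p a :
  upd (vcons u v) (lift ord0 p) a = vcons u (upd v p a).
Proof.
apply/funext => l; case: (unliftP ord0 l) => [q|] ->; last first.
  by rewrite upd_other ?neq_lift ?vcons0.
by rewrite vconsS /upd (inj_eq lift_inj) vconsS.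
Qed.

Lemma cochain_act_diff k (f : ('I_k -> L) -> M) : alt_multilinear f ->
  cochain_act (ce_diff rho f) = ce_diff rho (cochain_act f).
Proof.
move=> fA; apply/funext => v; rewrite /cochain_act /ce_diff.
rewrite big_split /= linearD opprD addrACA; congr (_ + _).
  rewrite exchange_big /= linear_sum -sumrB; apply: eq_bigr => j _.
  rewrite -scaler_sumr linearZ -scalerBr; congr (_ *: _) => /=.
  rewrite (bigD1_ord j) //= upd_same upd_lift eqv_rep.
  have rB x m p : rho x (m - p) = rho x m - rho x p.
    by rewrite -[- p]scaleN1r addrC (lieRep_linearr rho) scaleN1r addrC.
  have r0 x : rho x 0 = 0 by have := rB x 0 0; rewrite !subrr.
  have rS x (F : 'I_k -> M) : rho x (\sum_i F i) = \sum_i rho x (F i).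
    apply: (big_morph (rho x)) => // m p.
    by have := lieRep_linearr rho x 1 m p; rewrite !scale1r.
  rewrite rB rS opprD addrACA subrr add0r; congr (_ - _).
  apply: eq_bigr => p _; rewrite upd_liftr upd_other //.
  by rewrite neq_lift.
case: k f fA v => [|k] f fA v /=; first by rewrite linear0 big1 ?subrr.
rewrite exchange_big /= linear_sum -sumrB; apply: eq_bigr => j _.
rewrite exchange_big /= linear_sum -sumrB; apply: eq_bigr => i _.
rewrite -scaler_sumr linearZ -scalerBr; congr (_ *: (_ - _)).
rewrite (bigD1_ord j) //= (bigD1_ord i) //= big_ord_recl.
rewrite vcons0 upd_vcons0 eqv_lie -[vcons (_ + _) _](upd_vcons0 (lie (v (lift j i)) (v j))).
rewrite altD // !upd_vcons0 addrA [X in _ = X + _]addrC; congr (_ + _ + _).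
- rewrite upd_same upd_other 1?eq_sym ?neq_lift //; congr (f (vcons _ _)).
  by apply/funext => p; rewrite upd_other // eq_sym neq_lift.
- rewrite upd_same upd_other ?neq_lift //; congr (f (vcons _ _)).
  by apply/funext => p; rewrite upd_other // (inj_eq lift_inj) eq_sym neq_lift.
- apply: eq_bigr => p _; rewrite vconsS upd_vconsS.
  rewrite upd_other ?(inj_eq lift_inj) ?neq_lift // upd_other ?neq_lift //.
  congr (f (vcons _ _)); apply/funext => q.
  by rewrite /upd !(inj_eq lift_inj).
Qed.

Section Degree.
Variable k : nat.

Fact cocycle_act_subproof (z : cocycle rho k) : cochain_act z \in cocycle_pred rho k.
Proof.
have /asboolP[zA dz] := cocycle_valP z; apply/asboolP; split.
  exact: cochain_act_alt.
by rewrite -cochain_act_diff // dz linear0.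
Qed.
Definition cocycle_act (z : cocycle rho k) : cocycle rho k :=
  Cocycle (cocycle_act_subproof z).

Lemma cocycle_act_linear : linear cocycle_act.
Proof. by move=> a y z; apply/val_inj; rewrite /= linearP. Qed.

Lemma cocycle_act_coboundary z :
  z \in coboundary_pred rho k -> cocycle_act z \in coboundary_pred rho k.
Proof.
move=> /asboolP zB; apply/asboolP => /=; move: (cocycle_val z) zB.
case: (k) => [|k'] f /=; first by move=> ->; rewrite linear0.
case=> g gA ->; exists (cochain_act g); first exact: cochain_act_alt.
by rewrite cochain_act_diff.
Qed.

Definition coh_act (h : coh rho k) : coh rho k :=
  \pi_(lmod_quot (coboundary_pred rho k)) (cocycle_act (repr h)).

Lemma coh_act_pi (z : cocycle rho k) :
  coh_act (\pi_(lmod_quot (coboundary_pred rho k)) z) =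
  \pi_(lmod_quot (coboundary_pred rho k)) (cocycle_act z).
Proof.
apply/eqP; rewrite /coh_act pi_lmod_eq.
have -> (x y : cocycle rho k) : cocycle_act x - cocycle_act y = cocycle_act (x - y).
  rewrite -scaleN1r addrC -cocycle_act_linear scaleN1r.
  by rewrite addrC.
by apply: cocycle_act_coboundary; rewrite -pi_lmod_eq reprK.
Qed.

Lemma coh_act_linear : linear coh_act.
Proof.
move=> a x y; rewrite -[x]reprK -[y]reprK.
rewrite -(pi_lmod_linear (coboundary_pred rho k)) !coh_act_pi.
by rewrite cocycle_act_linear pi_lmod_linear.
Qed.
HB.instance Definition _ :=
  GRing.isLinear.Build K (coh rho k) (coh rho k) *:%R coh_act coh_act_linear.

End Degree.
End CohomologyAction.

(* The elements of H^k annihilated by the operators induced by the family D. *)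
Section Invariants.
Variables (K : fieldType) (L : lieAlgType K) (M : lmodType K) (rho : lieRep L M).
Variables (A : Type) (D : A -> equivariance rho) (k : nat).

Definition coh_inv_pred : {pred coh rho k} :=
  [pred h | `[< forall a, coh_act (D a) h = 0 >]].
Fact coh_inv_pred_closed : submod_closed coh_inv_pred.
Proof.
split=> [|c g h]; first by apply/asboolP => a; rewrite linear0.
move=> /asboolP g0 /asboolP h0; apply/asboolP => a.
by rewrite linearP /= g0 h0 scaler0 addr0.
Qed.
HB.instance Definition _ :=
  GRing.isSubmodClosed.Build K (coh rho k) coh_inv_pred coh_inv_pred_closed.

Record coh_inv := CohInv {
  coh_inv_val :> coh rho k;
  coh_inv_valP : coh_inv_val \in coh_inv_pred
}.
HB.instance Definition _ := [isSub for coh_inv_val].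
HB.instance Definition _ := [Choice of coh_inv by <:].
HB.instance Definition _ := [SubChoice_isSubLmodule of coh_inv by <:].

End Invariants.

Definition infinitesimally_strongly_rigid (K : fieldType) (L : lieAlgType K) : Prop :=
  lmod_trivial (coh (sym_rep L) 2).

Section Affine.
Variables (K : fieldType) (m : nat).

Definition gl_lie : Type := 'M[K]_m.
HB.instance Definition _ := Vector.copy gl_lie 'M[K]_m.

Definition gl_bracket (x y : gl_lie) : gl_lie := x *m y - y *m x.
Fact gl_linearl y : linear (gl_bracket^~ y).
Proof.
move=> a u v; rewrite /gl_bracket mulmxDl mulmxDr -scalemxAl -scalemxAr.
by rewrite scalerBr opprD addrACA.
Qed.
Fact gl_linearr x : linear (gl_bracket x).
Proof.
move=> a u v; rewrite /gl_bracket mulmxDl mulmxDr -scalemxAl -scalemxAr.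
by rewrite scalerBr opprD addrACA.
Qed.
Fact gl_xx x : gl_bracket x x = 0.
Proof. exact: subrr. Qed.
Fact gl_jacobi x y z : gl_bracket x (gl_bracket y z) +
  gl_bracket y (gl_bracket z x) + gl_bracket z (gl_bracket x y) = 0.
Proof.
rewrite /gl_bracket !mulmxBl !mulmxBr !mulmxA.
set a := x *m y *m z; set b := x *m z *m y; set c := y *m z *m x.
set d := z *m y *m x; set e := y *m x *m z; set g := z *m x *m y.
rewrite !opprB !addrA; apply/matrixP => i j; rewrite !mxE; ring.
Qed.
HB.instance Definition _ := isLieAlgebra.Build K gl_lie
  gl_linearl gl_linearr gl_xx gl_jacobi.

Definition vec_lie : Type := 'cV[K]_m.
HB.instance Definition _ := Vector.copy vec_lie 'cV[K]_m.

Definition vec_bracket (x y : vec_lie) : vec_lie := 0.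
Fact vec_linearl y : linear (vec_bracket^~ y).
Proof. by move=> a u v; rewrite /vec_bracket scaler0 addr0. Qed.
Fact vec_linearr x : linear (vec_bracket x).
Proof. by move=> a u v; rewrite /vec_bracket scaler0 addr0. Qed.
Fact vec_xx x : vec_bracket x x = 0.
Proof. by []. Qed.
Fact vec_jacobi x y z : vec_bracket x (vec_bracket y z) +
  vec_bracket y (vec_bracket z x) + vec_bracket z (vec_bracket x y) = 0.
Proof. by rewrite /vec_bracket !addr0. Qed.
HB.instance Definition _ := isLieAlgebra.Build K vec_lie
  vec_linearl vec_linearr vec_xx vec_jacobi.

Definition aff_lie : Type := (gl_lie * vec_lie)%type.
HB.instance Definition _ := Vector.copy aff_lie (gl_lie * vec_lie)%type.

Definition aff_bracket (x y : aff_lie) : aff_lie :=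
  (lie x.1 y.1, x.1 *m y.2 - y.1 *m x.2).
Fact aff_linearl y : linear (aff_bracket^~ y).
Proof.
move=> a u v; congr (_, _) => /=; first by rewrite lieDl lieZl.
by rewrite mulmxDl mulmxDr -scalemxAl -scalemxAr scalerBr opprD addrACA.
Qed.
Fact aff_xx x : aff_bracket x x = 0.
Proof. by rewrite /aff_bracket liexx subrr. Qed.
Fact aff_linearr x : linear (aff_bracket x).
Proof.
move=> a u v; congr (_, _) => /=; first by rewrite lieDr lieZr.
by rewrite mulmxDl mulmxDr -scalemxAl -scalemxAr scalerBr opprD addrACA.
Qed.
Fact aff_jacobi x y z : aff_bracket x (aff_bracket y z) +
  aff_bracket y (aff_bracket z x) + aff_bracket z (aff_bracket x y) = 0.
Proof.
congr (_, _) => /=; first exact: lie_jacobi.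
rewrite /lie /= /gl_bracket !mulmxBl !mulmxBr !mulmxA.
by apply/matrixP => i j; rewrite !mxE; ring.
Qed.
HB.instance Definition _ := isLieAlgebra.Build K aff_lie
  aff_linearl aff_linearr aff_xx aff_jacobi.

Definition gl_aff (x : gl_lie) : aff_lie := (x, 0).
Definition vec_aff (v : vec_lie) : aff_lie := (0, v).

Fact vec_aff_linear : linear vec_aff.
Proof. by move=> a u v; congr (_, _); rewrite /= scaler0 addr0. Qed.
HB.instance Definition _ :=
  GRing.isLinear.Build K vec_lie aff_lie *:%R vec_aff vec_aff_linear.

Fact vec_aff_lie u v : vec_aff (lie u v) = lie (vec_aff u) (vec_aff v).
Proof. by congr (_, _) => /=; rewrite ?lie0x // !mul0mx subrr. Qed.
Lemma gl_vec_aff_lie x v : lie (gl_aff x) (vec_aff v) = vec_aff (x *m v).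
Proof. by congr (_, _) => /=; rewrite ?liex0 // mul0mx subr0. Qed.

Definition vec_aff_hom : lieHom vec_lie aff_lie := LieHom vec_aff_lie.

Definition vec_sym_rep : lieRep vec_lie (sym_alg aff_lie) :=
  lieRep_res vec_aff_hom (sym_rep aff_lie).

Section Equivariance.
Variable x : gl_lie.
Definition mulv (v : vec_lie) : vec_lie := x *m v.
Fact mulv_linear : linear mulv.
Proof. by move=> a u v; rewrite /mulv mulmxDr -scalemxAr. Qed.
HB.instance Definition _ :=
  GRing.isLinear.Build K vec_lie vec_lie *:%R mulv mulv_linear.
Fact mulv_lie u v : mulv (lie u v) = lie (mulv u) v + lie u (mulv v).
Proof. by rewrite /lie /= /vec_bracket addr0; exact: mulmx0. Qed.
Fact vec_sym_eqv (v : vec_lie) (p : sym_alg aff_lie) :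
  sym_act (gl_aff x) (vec_sym_rep v p) =
  vec_sym_rep (mulv v) p + vec_sym_rep v (sym_act (gl_aff x) p).
Proof.
apply/eqP; rewrite -subr_eq -sym_act_lie; apply/eqP.
by rewrite gl_vec_aff_lie.
Qed.
Definition gl_eqv : equivariance vec_sym_rep := Equivariance mulv_lie vec_sym_eqv.
End Equivariance.

End Affine.

(* Main.v *)
(** Write [g = gl_m + K^m] and let [x_ij], [y_i] be the coordinates of [gl_m] and
    [K^m] in [S g].  On [S g]-valued cochains of [g] multiplication by the
    symmetric degree is null-homotopic.  Indeed, up to sign, the part of the
    differential along [K^m] is [D = sum y_b theta_a d/dx_ba], where [theta_a] is the
    dual basis of [K^m]; pair it with [H = sum x_ba (d/dy_b) (d/dtheta_a)].  The
    anticommutator of [D] and [H] is the sum of a count of degrees and of quadratic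
    Casimir-like terms in the operators of [gl_m].  These terms vanish on
    invariants, and each of them is null-homotopic on cochains of [g], by a
    homotopy of the form [sum A(E_ij) i_(E_ji)] with [A] equivariant.  Hence only
    degree [0] coefficients contribute to the cohomology of [g], and then the weights
    of the identity matrix, which acts on [K^m] by [1] and on [gl_m] by [0],
    leave only the cochains of [gl_m].  Restricting the homotopy formula to [K^m]
    gives the statement on invariant classes without any complete reducibility.
    Finally [H^2(gl_m, K) = 0] by the usual Casimir argument. *)
Require Import Defs.
From HB Require Import structures.
From mathcomp Require Import all_boot all_order all_algebra.
From mathcomp Require Import boolp functions mpoly ring zify.
Set Implicit Arguments. Unset Strict Implicit. Unset Printing Implicit Defensive.
Import GRing.Theory.
Local Open Scope ring_scope.

(** The pieces of the homotopy, namely [H] and the operators paired with the [E_ij], are equivariant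
    under [gl_m] but not under [g]. So [euler_hom] neither anticommutes with contractions (the error
    is [euler_hom_defect]) nor commutes with the Lie derivatives along [K^m] (the error is
    [lie_defect]). The proof rests on the match of the two errors: [lie_defect] is the commutator of
    [euler_hom_defect] with the differential. As the recursion [i_u d = L_u - d i_u] determines [d],
    and contractions determine a cochain, the homotopy formula then propagates from degree 0 by
    induction, without signed sums over indices.

    In degree 0 it says that a second order differential operator on [S g] is twice the Euler
    operator, which explains the coefficients: with -2, -1 and 1 the second order symbols of the
    three quadratic families cancel; the first order part that remains is 2 on [gl_m] and 1 - m on
    [K^m], and m + 1 times the action of the identity matrix, which is 0 on [gl_m], raises the
    latter to 2. *)

(** * Reflective proof of equalities between linear combinations *)

Section LinearReflection.
Variables (K : fieldType) (V : lmodType K).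

Inductive lterm := LVar of nat | LZero | LAdd of lterm & lterm | LOpp of lterm
  | LScale of K & lterm | LMuln of lterm & nat.

Fixpoint leval (env : seq V) t : V := match t with
  | LVar i => nth 0 env i | LZero => 0
  | LAdd s t => leval env s + leval env t | LOpp t => - leval env t
  | LScale a t => a *: leval env t | LMuln t n => leval env t *+ n end.

Fixpoint lcoef t (j : nat) : K := match t with
  | LVar i => if i == j then 1 else 0 | LZero => 0
  | LAdd s t => lcoef s j + lcoef t j | LOpp t => - lcoef t j
  | LScale a t => a * lcoef t j | LMuln t n => lcoef t j * n%:R end.

Fixpoint lvars n t := match t with
  | LVar i => (i < n)%N | LZero => true
  | LAdd s t => lvars n s && lvars n t | LOpp t => lvars n t
  | LScale _ t => lvars n t | LMuln t _ => lvars n t end.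

(** A conjunction of equations rather than a Boolean test: the coefficients are symbolic, and each
    equation is left to [ring]. *)
Fixpoint lcheck n s t : Prop := match n with
  | 0 => True | j.+1 => lcoef s j = lcoef t j /\ lcheck j s t end.

Lemma levalE env t : lvars (size env) t ->
  leval env t = \sum_(j < size env) lcoef t j *: env`_j.
Proof.
elim: t => [i|| s IHs t IHt|t IH|a t IH|t IH n] /=.
- move=> lti; rewrite (bigD1 (Ordinal lti)) //= eqxx scale1r big1 ?addr0 // => j.
  by rewrite eq_sym -val_eqE /= => /negbTE->; rewrite scale0r.
- by rewrite big1 // => j _; rewrite scale0r.
- case/andP=> /IHs-> /IHt->; rewrite -big_split; apply: eq_bigr => j _.
  by rewrite /= scalerDl.
- by move=> /IH->; rewrite -sumrN; apply: eq_bigr => j _; rewrite scaleNr.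
- by move=> /IH->; rewrite scaler_sumr; apply: eq_bigr => j _; rewrite scalerA.
- move=> /IH->; rewrite -sumrMnl; apply: eq_bigr => j _.
  by rewrite -scaler_nat scalerA mulrC.
Qed.

Lemma lcheckP env s t : lvars (size env) s && lvars (size env) t ->
  lcheck (size env) s t -> leval env s = leval env t.
Proof.
case/andP=> vs vt; rewrite !levalE // => st; apply: eq_bigr => j _; congr (_ *: _).
elim: (size env) st j => [|n IH] /= st [j /= jn] //; case: st => st0 st.
have [->//|nj] := eqVneq j n.
have jn' : (j < n)%N by rewrite ltn_neqAle nj.
exact: (IH st (Ordinal jn')).
Qed.
End LinearReflection.

(** The match on [constr:(Set)] lets [unify] run while a term is being built; its failure selects
    the second branch, which tries the next atom. *)
Ltac lmod_atom x l := lazymatch l with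
  | nil => constr:(cons x nil)
  | cons ?y ?t => match constr:(Set) with
    | _ => let _ := match goal with _ => unify x y end in l
    | _ => let t' := lmod_atom x t in constr:(cons y t') end end.
Ltac lmod_atoms t l := lazymatch t with
  | (?a + ?b)%R => let l' := lmod_atoms a l in lmod_atoms b l'
  | (- ?a)%R => lmod_atoms a l
  | (?a *+ _)%R => lmod_atoms a l
  | (_ *: ?a)%R => lmod_atoms a l
  | 0%R => l
  | _ => lmod_atom t l end.
Ltac lmod_index x l := lazymatch l with
  | cons ?y ?t => match constr:(Set) with
    | _ => let _ := match goal with _ => unify x y end in constr:(0%N)
    | _ => let n := lmod_index x t in constr:(S n) end end.
Ltac lmod_reify K t l := lazymatch t with
  | (?a + ?b)%R => let a' := lmod_reify K a l in let b' := lmod_reify K b l in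
      constr:(@LAdd K a' b')
  | (- ?a)%R => let a' := lmod_reify K a l in constr:(@LOpp K a')
  | (?a *+ ?n)%R => let a' := lmod_reify K a l in constr:(@LMuln K a' n)
  | (?c *: ?a)%R => let a' := lmod_reify K a l in constr:(@LScale K c a')
  | 0%R => constr:(@LZero K)
  | _ => let n := lmod_index t l in constr:(@LVar K n) end.
(* Proves equalities between formal linear combinations of the same vectors;
   vectors are identified up to conversion. *)
Ltac lmod K := rewrite /reverse_coercion /=; lazymatch goal with |- @eq ?V ?s ?t =>
  let l0 := lmod_atoms s (@nil V) in let l := lmod_atoms t l0 in
  let s' := lmod_reify K s l in let t' := lmod_reify K t l in
  apply: (@lcheckP K _ l s' t'); [reflexivity | rewrite /=; repeat split; ring] end.

HB.instance Definition _ (K : fieldType) (L : lieAlgType K) (x : L) :=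
  GRing.isLinear.Build K L L *:%R (lie x) (lie_linearr x).
HB.instance Definition _ (K : fieldType) (L : lieAlgType K) (M : lmodType K)
    (rho : lieRep L M) (x : L) :=
  GRing.isLinear.Build K M M *:%R (rho x) (lieRep_linearr rho x).

(** * Cochains *)

Section Alternating.
Variables (K : fieldType) (L : lieAlgType K) (M : lmodType K).

Lemma vcons_eta k (v : 'I_k.+1 -> L) :
  vcons (v ord0) (fun p => v (lift ord0 p)) = v.
Proof.
by apply/funext => l; case: (unliftP ord0 l) => [p|] ->; rewrite ?vconsS ?vcons0.
Qed.

Lemma ord0_fun (v w : 'I_0 -> L) : v = w.
Proof. by apply/funext => -[]. Qed.

(** By antisymmetry in the tail, an argument equal to [u] can be moved to the first place of the
    tail, so the vanishing has to be checked only there. *)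
Lemma alt_cons k (f : ('I_k.+1 -> L) -> M) :
  (forall v, linear (fun u => f (vcons u v))) ->
  (forall u, alt_multilinear (fun v => f (vcons u v))) ->
  (forall u v (i : 'I_k), val i = 0%N -> v i = u -> f (vcons u v) = 0) ->
  alt_multilinear f.
Proof.
move=> f_lin f_alt f_eq.
have f_eq' u (v : 'I_k -> L) i : v i = u -> f (vcons u v) = 0.
  case: k f f_lin f_alt f_eq v i => [|k] f _ f_alt f_eq v i vi; first by case: i vi.
  have [i0|ni0] := eqVneq i ord0; first by apply: (f_eq u v i) => //; rewrite i0.
  have := alt_swap v u (v ord0) (f_alt u) ni0.
  rewrite (f_eq u (upd _ ord0 u) ord0) ?upd_same // addr0.
  by rewrite [upd v i u]upd_id // upd_id.
split=> v i; case: (unliftP ord0 i) => [p|] ->.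
- by move=> a x y; rewrite -(vcons_eta v) !upd_vconsS; apply: (f_alt _).1.
- by move=> a x y; rewrite -(vcons_eta v) !upd_vcons0; apply: f_lin.
- move=> j; rewrite -(vcons_eta v); case: (unliftP ord0 j) => [q|] -> nij.
    rewrite !vconsS => vpq; apply: ((f_alt _).2 _ p q) vpq.
    by apply: contraNneq nij => ->.
  by rewrite vconsS vcons0; apply: f_eq'.
- move=> j; case: (unliftP ord0 j) => [q|] -> nij vij; last by rewrite eqxx in nij.
  by rewrite -(vcons_eta v); apply: (f_eq' _ _ q); rewrite -vij.
Qed.

Lemma alt_contr k (f : ('I_k.+1 -> L) -> M) u :
  alt_multilinear f -> alt_multilinear (fun v => f (vcons u v)).
Proof.
case=> fl fa; split=> [v i a x y|v i j nij vij].
  by rewrite -!upd_vconsS fl.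
by apply: (fa _ (lift ord0 i) (lift ord0 j)); rewrite ?(inj_eq lift_inj) // !vconsS.
Qed.

Lemma alt_contr_linear k (f : ('I_k.+1 -> L) -> M) v :
  alt_multilinear f -> linear (fun u => f (vcons u v)).
Proof.
case=> fl _ a x y; have E z : vcons z v = upd (vcons 0 v) ord0 z by rewrite upd_vcons0.
by rewrite (E (a *: x + y)) (E x) (E y) fl.
Qed.

(** Moving the [j]-th argument to the front takes [j] transpositions; this matches the signs in
    [ce_diff]. *)
Lemma alt_move k (f : ('I_k.+1 -> L) -> M) v (j : 'I_k.+1) :
  alt_multilinear f ->
  f v = (-1) ^+ j *: f (vcons (v j) (fun p => v (lift j p))).
Proof.
elim: k f v j => [|k IH] f v j fA.
  rewrite (ord1 j) expr0 scale1r; congr f; rewrite -[LHS]vcons_eta.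
  by congr (vcons _ _); apply: ord0_fun.
case: (unliftP ord0 j) => [p|] ->; last by rewrite expr0 scale1r vcons_eta.
rewrite -[v in LHS]vcons_eta (IH _ _ p (alt_contr _ fA)).
rewrite lift0 exprS -scalerA scaleN1r -scalerN; congr (_ *: _).
set a := v _; set b := v _; set w := fun _ => _.
have -> : (fun q => v (lift (lift ord0 p) q)) = vcons a w.
  rewrite -[LHS]vcons_eta; congr (vcons _ _).
    by congr v; apply/val_inj.
  by apply/funext => q; congr v; apply/val_inj; rewrite /= /bump; lia.
have := alt_swap (vcons a (vcons a w)) a b fA (isT : ord0 != lift ord0 ord0).
by rewrite !upd_vcons0 !upd_vconsS !upd_vcons0 => /eqP; rewrite addr_eq0 => /eqP.
Qed.

Definition alt_pred k : {pred ('I_k -> L) -> M} := [pred f | `[< alt_multilinear f >]].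
Fact alt_pred_closed k : submod_closed (@alt_pred k).
Proof.
split=> [|a f g]; first by apply/asboolP; exact: alt_multilinear0.
by move=> /asboolP fA /asboolP gA; apply/asboolP; exact: alt_multilinearP.
Qed.
HB.instance Definition _ k := GRing.isSubmodClosed.Build K (('I_k -> L) -> M)
  (@alt_pred k) (@alt_pred_closed k).

Record cochain k := Cochain {
  cochain_val :> ('I_k -> L) -> M;
  cochain_valP : cochain_val \in @alt_pred k
}.
HB.instance Definition _ k := [isSub for @cochain_val k].
HB.instance Definition _ k := [Choice of cochain k by <:].
HB.instance Definition _ k := [SubChoice_isSubLmodule of cochain k by <:].

Lemma cochain_alt k (f : cochain k) : alt_multilinear f.
Proof. exact/asboolP/cochain_valP. Qed.

Definition mk_cochain k (f : ('I_k -> L) -> M) (fA : alt_multilinear f) : cochain k :=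
  Cochain (introT (asboolP _) fA).

Lemma cochainP k (f g : cochain k) : (forall v, f v = g v) <-> f = g.
Proof. by split=> [fg|->//]; apply/val_inj/funext. Qed.

Lemma cochainD k (f g : cochain k) v : (f + g) v = f v + g v.
Proof. by []. Qed.
Lemma cochainZ k a (f : cochain k) v : (a *: f) v = a *: f v.
Proof. by []. Qed.
Lemma cochainN k (f : cochain k) v : (- f) v = - f v.
Proof. by []. Qed.
Lemma cochain0 k v : (0 : cochain k) v = 0.
Proof. by []. Qed.
Lemma cochain_sum k I (r : seq I) (P : pred I) (F : I -> cochain k) v :
  (\sum_(i <- r | P i) F i) v = \sum_(i <- r | P i) F i v.
Proof. by elim/big_rec2: _ => // i _ f _ <-. Qed.
End Alternating.

(** * Contractions, endomorphisms acting on the arguments, and maps of coefficients *)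

Section Operators.
Variables (K : fieldType) (L : lieAlgType K) (M : lmodType K).
Implicit Types (u w : L).

Definition contr k u (f : cochain L M k.+1) : cochain L M k :=
  mk_cochain (alt_contr u (cochain_alt f)).

Lemma contrE k u (f : cochain L M k.+1) v : contr u f v = f (vcons u v).
Proof. by []. Qed.

Fact contr_is_linear k u : linear (@contr k u).
Proof. by move=> a f g; apply/cochainP. Qed.
HB.instance Definition _ k u := GRing.isLinear.Build K (cochain L M k.+1)
  (cochain L M k) *:%R (@contr k u) (contr_is_linear u).

Lemma contr_linearl k a u w (f : cochain L M k.+1) :
  contr (a *: u + w) f = a *: contr u f + contr w f.
Proof. by apply/cochainP => v; apply: (alt_contr_linear v (cochain_alt f)). Qed.

Lemma contrDl k u w (f : cochain L M k.+1) : contr (u + w) f = contr u f + contr w f.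
Proof. by rewrite -[u]scale1r contr_linearl !scale1r. Qed.
Lemma contr0l k (f : cochain L M k.+1) : contr 0 f = 0.
Proof. by have := contr_linearl (-1) 0 0 f; rewrite scaler0 addr0 scaleN1r addNr. Qed.
Lemma contrZl k a u (f : cochain L M k.+1) : contr (a *: u) f = a *: contr u f.
Proof. by have := contr_linearl a u 0 f; rewrite contr0l !addr0. Qed.
Lemma contrNl k u (f : cochain L M k.+1) : contr (- u) f = - contr u f.
Proof. by rewrite -scaleN1r contrZl scaleN1r. Qed.
Lemma contr_suml k I (r : seq I) (P : pred I) (F : I -> L) (f : cochain L M k.+1) :
  contr (\sum_(i <- r | P i) F i) f = \sum_(i <- r | P i) contr (F i) f.
Proof. by apply: (big_morph (fun x => contr x f)) => [x y|]; rewrite ?contrDl ?contr0l. Qed.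

(** The source of the inductions on the degree: an identity between cochains is checked after
    contraction with an arbitrary vector. *)
Lemma contr_ext k (f g : cochain L M k.+1) :
  (forall u, contr u f = contr u g) -> f = g.
Proof.
move=> fg; apply/cochainP => v; rewrite -(vcons_eta v).
by have /cochainP := fg (v ord0); apply.
Qed.

Lemma contr_anti k u (f : cochain L M k.+2) : contr u (contr u f) = 0.
Proof.
apply/cochainP => v; rewrite cochain0.
apply: ((cochain_alt f).2 _ ord0 (lift ord0 ord0)) => //.
by rewrite vconsS !vcons0.
Qed.

Lemma contrC k u w (f : cochain L M k.+2) : contr u (contr w f) = - contr w (contr u f).
Proof.
have := contr_anti (u + w) f; rewrite !contrDl !linearD /= !contr_anti add0r addr0.
by move=> /eqP; rewrite addr_eq0 => /eqP.
Qed.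

Section Sub.
Variable tau : {linear L -> L}.

Definition sub_fun k (f : ('I_k -> L) -> M) : ('I_k -> L) -> M :=
  fun v => \sum_(l < k) f (upd v l (tau (v l))).

Lemma sub_fun_vcons k (f : ('I_k.+1 -> L) -> M) u v :
  sub_fun f (vcons u v) =
  f (vcons (tau u) v) + sub_fun (fun w : 'I_k -> L => f (vcons u w)) v.
Proof.
rewrite /sub_fun big_ord_recl vcons0 upd_vcons0; congr (_ + _).
by apply: eq_bigr => l _; rewrite vconsS upd_vconsS.
Qed.

Lemma sub_alt k (f : ('I_k -> L) -> M) : alt_multilinear f -> alt_multilinear (sub_fun f).
Proof.
elim: k f => [|k IH] f fA; first by split=> [v []|v []].
have E u : (fun v => sub_fun f (vcons u v)) =
  1 *: (fun v => f (vcons (tau u) v)) + sub_fun (fun w : 'I_k -> L => f (vcons u w)).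
  by apply/funext => v; rewrite sub_fun_vcons scale1r.
have fL (v : 'I_k -> L) := alt_contr_linear v fA.
apply: alt_cons => [v a x y|u|u v i _ vi].
- rewrite !sub_fun_vcons linearP fL scalerDr -!addrA; congr (_ + _).
  rewrite addrCA; congr (_ + _); rewrite /sub_fun scaler_sumr -big_split /=.
  by apply: eq_bigr => l _; rewrite fL.
- by rewrite E; apply: alt_multilinearP; [apply: alt_contr|apply/IH/alt_contr].
rewrite sub_fun_vcons /sub_fun (bigD1 i) //= [X in _ + (_ + X)]big1 => [|l nli].
  have := alt_swap (vcons u v) (tau u) u fA (neq_lift ord0 i).
  rewrite !upd_vcons0 !upd_vconsS [upd v i u]upd_id // vi addr0; apply.
apply: (fA.2 _ ord0 (lift ord0 i)) => //.
by rewrite vcons0 vconsS upd_other // eq_sym.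
Qed.

Definition sub k (f : cochain L M k) : cochain L M k :=
  mk_cochain (sub_alt (cochain_alt f)).

Lemma subE k (f : cochain L M k) v : sub f v = \sum_(l < k) f (upd v l (tau (v l))).
Proof. by []. Qed.

Fact sub_is_linear k : linear (@sub k).
Proof.
move=> a f g; apply/cochainP => v.
by rewrite cochainD cochainZ !subE scaler_sumr -big_split.
Qed.
HB.instance Definition _ k := GRing.isLinear.Build K (cochain L M k)
  (cochain L M k) *:%R (@sub k) (@sub_is_linear k).

Lemma sub0c (f : cochain L M 0) : sub f = 0.
Proof. by apply/cochainP => v; rewrite subE big_ord0. Qed.

Lemma contr_sub k u (f : cochain L M k.+1) :
  contr u (sub f) = sub (contr u f) + contr (tau u) f.
Proof. by apply/cochainP => v; rewrite addrC; exact: sub_fun_vcons. Qed.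
End Sub.

Lemma sub_comb (tau t1 t2 : {linear L -> L}) a k (f : cochain L M k) :
  (forall y, tau y = a *: t1 y + t2 y) -> sub tau f = a *: sub t1 f + sub t2 f.
Proof.
move=> E; elim: k f => [|k IH] f; first by rewrite !sub0c scaler0 addr0.
apply: contr_ext => u; rewrite linearP /= !contr_sub IH E contr_linearl scalerDr.
by rewrite addrACA.
Qed.

Lemma sub_eq (tau t1 : {linear L -> L}) k (f : cochain L M k) :
  tau =1 t1 -> sub tau f = sub t1 f.
Proof. by move=> E; apply/cochainP => v; rewrite !subE; apply: eq_bigr => l _; rewrite E. Qed.

Lemma sub_null (tau : {linear L -> L}) k (f : cochain L M k) :
  (forall y, tau y = 0) -> sub tau f = 0.
Proof.
move=> E; have := @sub_comb tau tau tau (-1) _ f.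
rewrite scaleN1r addNr; apply=> y; rewrite !E scaler0 addr0 //.
Qed.

(** Substitution in the arguments is contravariant, whence the reversed commutator. *)
Lemma sub_comm (t1 t2 tau : {linear L -> L}) k (f : cochain L M k) :
  (forall y, tau y = t2 (t1 y) - t1 (t2 y)) ->
  sub t1 (sub t2 f) = sub t2 (sub t1 f) + sub tau f.
Proof.
move=> E; elim: k f => [|k IH] f; first by rewrite !sub0c addr0.
apply: contr_ext => u; rewrite linearD /= !contr_sub !linearD /= ?contr_sub IH E.
by rewrite contrDl contrNl; lmod K.
Qed.

Lemma sub_id k (f : cochain L M k) : sub idfun f = f *+ k.
Proof.
apply/cochainP => v; rewrite subE (eq_bigr (fun=> f v)) => [|l _]; last by rewrite upd_id.
have E n : (f *+ n) v = f v *+ n by elim: n => // n IH; rewrite !mulrS -IH.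
by rewrite sumr_const card_ord E.
Qed.

Section Post.
Variable M' : lmodType K.

Fact post_alt (P : {linear M -> M'}) k (f : ('I_k -> L) -> M) :
  alt_multilinear f -> alt_multilinear (P \o f).
Proof.
case=> fl fa; split=> [v i a x y|v i j nij vij] /=; first by rewrite fl linearP.
by rewrite (fa _ _ _ nij vij) linear0.
Qed.
Definition post (P : {linear M -> M'}) k (f : cochain L M k) : cochain L M' k :=
  mk_cochain (post_alt P (cochain_alt f)).

Lemma postE P k (f : cochain L M k) v : post P f v = P (f v).
Proof. by []. Qed.

Fact post_is_linear P k : linear (@post P k).
Proof. by move=> a f g; apply/cochainP => v; rewrite postE cochainD cochainZ linearP. Qed.
HB.instance Definition _ P k := GRing.isLinear.Build K (cochain L M k)
  (cochain L M' k) *:%R (@post P k) (@post_is_linear P k).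

End Post.
End Operators.

Section Post2.
Variables (K : fieldType) (L : lieAlgType K) (M M1 M2 : lmodType K).

Lemma contr_post (P : {linear M -> M1}) k u (f : cochain L M k.+1) :
  contr u (post P f) = post P (contr u f).
Proof. by apply/cochainP. Qed.

Lemma post_sub (P : {linear M -> M1}) (tau : {linear L -> L}) k (f : cochain L M k) :
  post P (sub tau f) = sub tau (post P f).
Proof. by apply/cochainP => v; rewrite postE !subE linear_sum. Qed.

Lemma post_eq (P Q : {linear M -> M1}) k (f : cochain L M k) :
  (forall x, P x = Q x) -> post P f = post Q f.
Proof. by move=> PQ; apply/cochainP => v; rewrite !postE. Qed.

Lemma post_comp (Q : {linear M1 -> M2}) (P : {linear M -> M1}) (R : {linear M -> M2})
    k (f : cochain L M k) :
  (forall x, R x = Q (P x)) -> post Q (post P f) = post R f.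
Proof. by move=> RQP; apply/cochainP => v; rewrite !postE. Qed.

Lemma post_comb (P P1 P2 : {linear M -> M1}) a k (f : cochain L M k) :
  (forall x, P x = a *: P1 x + P2 x) -> post P f = a *: post P1 f + post P2 f.
Proof. by move=> E; apply/cochainP => v; rewrite cochainD cochainZ !postE. Qed.

Lemma post_comm (P Q R : {linear M -> M}) k (f : cochain L M k) :
  (forall x, P (Q x) = Q (P x) + R x) ->
  post P (post Q f) = post Q (post P f) + post R f.
Proof. by move=> E; apply/cochainP => v; rewrite cochainD !postE. Qed.

Lemma post_id (P : {linear M -> M}) k (f : cochain L M k) :
  (forall x, P x = x) -> post P f = f.
Proof. by move=> E; apply/cochainP => v; rewrite postE. Qed.

Lemma post_null (P : {linear M -> M1}) k (f : cochain L M k) :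
  (forall x, P x = 0) -> post P f = 0.
Proof. by move=> E; apply/cochainP => v; rewrite postE. Qed.
End Post2.

(** * Pullback of cochains along a linear map *)

Section Pull.
Variables (K : fieldType) (L1 L2 : lieAlgType K) (M : lmodType K).
Variable phi : {linear L2 -> L1}.

Fact pull_alt k (f : ('I_k -> L1) -> M) :
  alt_multilinear f -> alt_multilinear (fun v => f (phi \o v)).
Proof.
have E (v : 'I_k -> L2) i u : phi \o upd v i u = upd (phi \o v) i (phi u).
  by apply/funext => l; rewrite /upd /=; case: eqP.
case=> fl fa; split=> [v i a x y|v i j nij vij]; first by rewrite !E linearP fl.
by apply: (fa _ i j) => //=; rewrite vij.
Qed.
Definition pull k (f : cochain L1 M k) : cochain L2 M k :=
  mk_cochain (pull_alt (cochain_alt f)).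

Lemma pullE k (f : cochain L1 M k) v : pull f v = f (phi \o v).
Proof. by []. Qed.

Fact pull_is_linear k : linear (@pull k).
Proof. by move=> a f g; apply/cochainP. Qed.
HB.instance Definition _ k := GRing.isLinear.Build K (cochain L1 M k)
  (cochain L2 M k) *:%R (@pull k) (@pull_is_linear k).

Lemma vcons_comp k u (v : 'I_k -> L2) : phi \o vcons u v = vcons (phi u) (phi \o v).
Proof. by apply/funext => l; rewrite /vcons /=; case: unlift. Qed.

Lemma contr_pull k u (f : cochain L1 M k.+1) :
  contr u (pull f) = pull (contr (phi u) f).
Proof. by apply/cochainP => v; rewrite contrE !pullE contrE vcons_comp. Qed.

Lemma pull_sub (t1 : {linear L1 -> L1}) (t2 : {linear L2 -> L2}) k (f : cochain L1 M k) :
  (forall y, phi (t2 y) = t1 (phi y)) -> pull (sub t1 f) = sub t2 (pull f).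
Proof.
move=> E; elim: k f => [|k IH] f; first by rewrite !sub0c linear0.
apply: contr_ext => u; rewrite contr_pull !contr_sub !linearD /= IH !contr_pull.
by rewrite E.
Qed.
End Pull.

(** * Cartan calculus for the Chevalley-Eilenberg differential *)

Section Differential.
Variables (K : fieldType) (L : lieAlgType K) (M : lmodType K) (rho : lieRep L M).
Implicit Types (u w : L).

(* Locked so that additivity lemmas do not see through the difference. *)
Definition lieder u k (f : cochain L M k) : cochain L M k :=
  locked (post (rho u) f - sub (lie u) f).

Lemma liederE u k (f : cochain L M k) : lieder u f = post (rho u) f - sub (lie u) f.
Proof. by rewrite /lieder -lock. Qed.

Fact lieder_is_linear u k : linear (@lieder u k).
Proof. by move=> a f g; rewrite !liederE !linearP /=; lmod K. Qed.
HB.instance Definition _ u k := GRing.isLinear.Build K (cochain L M k)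
  (cochain L M k) *:%R (@lieder u k) (@lieder_is_linear u k).

Lemma lieder_linearl a u w k (f : cochain L M k) :
  lieder (a *: u + w) f = a *: lieder u f + lieder w f.
Proof.
rewrite !liederE (@post_comb _ _ _ _ _ (rho u) (rho w) a); last first.
  by move=> x; apply: lieRep_linearl.
rewrite (@sub_comb _ _ _ _ (lie u) (lie w) a) => [|y]; last exact: lie_linearl.
by lmod K.
Qed.

Lemma lieder0l k (f : cochain L M k) : lieder 0 f = 0.
Proof. by have := lieder_linearl (-1) 0 0 f; rewrite scaler0 addr0 scaleN1r addNr. Qed.
Lemma liederDl u w k (f : cochain L M k) : lieder (u + w) f = lieder u f + lieder w f.
Proof. by rewrite -[u]scale1r lieder_linearl !scale1r. Qed.
Lemma liederNl u k (f : cochain L M k) : lieder (- u) f = - lieder u f.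
Proof. by have := lieder_linearl (-1) u 0 f; rewrite lieder0l !addr0 !scaleN1r. Qed.

Lemma contr_lieder u w k (f : cochain L M k.+1) :
  contr w (lieder u f) = lieder u (contr w f) - contr (lie u w) f.
Proof. by rewrite !liederE linearB /= contr_post contr_sub; lmod K. Qed.

Lemma lieder_lieder u w k (f : cochain L M k) :
  lieder u (lieder w f) = lieder w (lieder u f) + lieder (lie u w) f.
Proof.
rewrite !liederE !linearB /= !post_sub.
rewrite (@post_comm _ _ _ _ _ (rho (lie u w))); last by move=> x /=; rewrite lieRep_lie; lmod K.
have E : sub (lie u) (sub (lie w) f) = sub (lie w) (sub (lie u) f) - sub (lie (lie u w)) f.
  rewrite (@sub_comm _ _ _ (lie w) (lie u) (lie (lie u w))) ?addrK // => y.
  by rewrite /= lie_lie.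
by rewrite E; lmod K.
Qed.

Lemma lift_lift0 k (j : 'I_k.+1) : lift (lift ord0 j) (ord0 : 'I_k.+1) = ord0.
Proof. exact/val_inj. Qed.

Lemma lift_liftS k (j : 'I_k.+1) (p : 'I_k) :
  lift (lift ord0 j) (lift ord0 p) = lift ord0 (lift j p).
Proof. by apply/val_inj; rewrite /= /bump; lia. Qed.

Lemma vcons_lift k u (v : 'I_k.+1 -> L) (j : 'I_k.+1) :
  (fun p => vcons u v (lift (lift ord0 j) p)) = vcons u (fun p => v (lift j p)).
Proof.
rewrite -[LHS]vcons_eta; congr (vcons _ _).
  by rewrite lift_lift0 vcons0.
apply/funext => p; by rewrite lift_liftS vconsS.
Qed.

(** The pairs with [i = 0] bracket [u] with another argument and form the first sum; in the other
    pairs [u] and the bracket trade places, which costs a sign. *)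
Lemma ce_diff_lie_vcons k (f : ('I_k.+1 -> L) -> M) u v : alt_multilinear f ->
  ce_diff_lie f (vcons u v) =
  - (\sum_(j < k.+1) f (upd v j (lie u (v j)))) -
  ce_diff_lie (fun x : 'I_k -> L => f (vcons u x)) v.
Proof.
move=> fA; have b0 n : bump 0 n = n.+1 by [].
rewrite [LHS]/ce_diff_lie big_ord_recl big_pred0 // add0r.
under eq_bigr => j _ do rewrite big_mkcond big_ord_recl /=.
rewrite big_split /=; congr (_ + _).
  rewrite -sumrN; apply: eq_bigr => j _.
  rewrite b0 add0n exprS -scalerA scaleN1r; congr (- _).
  rewrite (alt_move (upd v j _) j fA) upd_same; congr (_ *: f (vcons _ _)).
    congr (lie _ _); last by rewrite vconsS.
    by rewrite lift_lift0 vcons0.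
  rewrite upd_lift; apply/funext => p.
  by rewrite lift_liftS vconsS.
case: k f fA u v => [|k] f fA u v /=.
  by rewrite big1 ?oppr0 // => j _; rewrite big_ord0.
rewrite -sumrN; apply: eq_bigr => j _; rewrite -big_mkcond -sumrN /=.
apply: eq_big => i; first by rewrite !b0.
move=> _; rewrite !b0 addSn addnS !exprS !mulN1r opprK -scalerN; congr (_ *: _).
rewrite vconsS lift_liftS vconsS.
rewrite (_ : (fun p => _) = vcons u (fun p => v (lift j (lift i p)))); last first.
  have := vcons_lift u (fun p => v (lift j p)) i => <-; apply/funext => p.
  by rewrite -vcons_lift.
set a := lie _ _; set x := fun p => _.
have := alt_swap (vcons a (vcons a x)) a u fA (isT : ord0 != lift ord0 ord0).
by rewrite !upd_vcons0 !upd_vconsS !upd_vcons0 => /eqP; rewrite addr_eq0 => /eqP.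
Qed.

(** Cartan's formula [i_u d = L_u - d i_u], stated on bare functions because [ce_diff rho f] is not
    yet known to be alternating. *)
Lemma ce_diff_vconsS k (f : ('I_k.+1 -> L) -> M) u v : alt_multilinear f ->
  ce_diff rho f (vcons u v) =
  rho u (f v) - (\sum_(j < k.+1) f (upd v j (lie u (v j)))) -
  ce_diff rho (fun x : 'I_k -> L => f (vcons u x)) v.
Proof.
move=> fA; rewrite /ce_diff ce_diff_lie_vcons // big_ord_recl expr0 scale1r.
rewrite vcons0 (_ : (fun p => vcons u v _) = v); last by apply/funext => p; rewrite vconsS.
under eq_bigr => j _ do rewrite lift0 exprS mulN1r scaleNr vconsS vcons_lift.
rewrite sumrN; set S := \sum_i _; rewrite -[X in _ - (X + _)]/S; lmod K.
Qed.

Lemma ce_diff_vcons0 (f : ('I_0 -> L) -> M) u v :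
  ce_diff rho f (vcons u v) = rho u (f v).
Proof.
rewrite /ce_diff /= big_ord1 expr0 scale1r addr0 vcons0; congr (rho _ (f _)).
exact: ord0_fun.
Qed.

(** Cartan's formula reduces this to lower degree: two contractions with the same [u] leave
    [L_u i_u f - L_u i_u f + d i_u i_u f = 0]. *)
Lemma ce_diff_alt k (f : ('I_k -> L) -> M) :
  alt_multilinear f -> alt_multilinear (ce_diff rho f).
Proof.
elim: k f => [|k IH] f fA.
  apply: alt_cons => [v a x y|u|u v []//]; last by split=> v [].
  by rewrite !ce_diff_vcons0; apply: lieRep_linearl.
pose F := mk_cochain fA.
have E u v : ce_diff rho f (vcons u v) = lieder u F v - ce_diff rho (contr u F) v.
  by rewrite ce_diff_vconsS // liederE.
have ceP a (x y : cochain L M k) v : ce_diff rho (a *: x + y : cochain _ _ _) v =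
    a *: ce_diff rho x v + ce_diff rho y v.
  exact: (congr1 (fun g => g v) (ce_diff_linear rho a x y)).
apply: alt_cons => [v a x y|u|u v i i0 vi].
- by rewrite !E lieder_linearl contr_linearl ceP cochainD cochainZ; lmod K.
- rewrite (_ : (fun v => _) = (-1) *: ce_diff rho (contr u F) + lieder u F).
    by apply: alt_multilinearP; [apply/IH/cochain_alt|apply: cochain_alt].
  by apply/funext => v; rewrite E [LHS]addrC; congr (_ + _); rewrite -scaleN1r.
have -> : v = vcons u (fun p => v (lift ord0 p)).
  by rewrite -{1}(vcons_eta v) -vi; congr (vcons (v _) _); apply/val_inj.
set w := fun p => _; rewrite E -contrE contr_lieder liexx contr0l subr0.
move: w => w {IH E ceP i0 vi}; move: i => _; move: v => _.
case: k f fA F w => [|k] f fA F w.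
  by rewrite ce_diff_vcons0 liederE sub0c subr0 postE subrr.
rewrite ce_diff_vconsS; last exact: cochain_alt.
rewrite (_ : (fun x => _) = contr u (contr u F) :> (_ -> _)) // contr_anti.
by rewrite liederE (linear0 (@ce_diff _ _ _ rho k)) subr0; apply: subrr.
Qed.

Definition dif k (f : cochain L M k) : cochain L M k.+1 :=
  mk_cochain (ce_diff_alt (cochain_alt f)).

Lemma difE k (f : cochain L M k) : dif f = ce_diff rho f :> (_ -> _).
Proof. by []. Qed.

Fact dif_is_linear k : linear (@dif k).
Proof. by move=> a f g; apply/val_inj; exact: (ce_diff_linear rho a f g). Qed.
HB.instance Definition _ k := GRing.isLinear.Build K (cochain L M k)
  (cochain L M k.+1) *:%R (@dif k) (@dif_is_linear k).

Lemma contr_difS k u (f : cochain L M k.+1) :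
  contr u (dif f) = lieder u f - dif (contr u f).
Proof. apply/cochainP => v; rewrite liederE; exact/ce_diff_vconsS/cochain_alt. Qed.

Lemma contr_dif0 u (f : cochain L M 0) : contr u (dif f) = lieder u f.
Proof.
apply/cochainP => v; rewrite !liederE sub0c subr0; exact: ce_diff_vcons0.
Qed.

Lemma contr_contr_dif u w k (f : cochain L M k.+2) :
  contr u (contr w (dif f)) =
  contr u (lieder w f) - lieder u (contr w f) + dif (contr u (contr w f)).
Proof. by rewrite contr_difS linearB /= contr_difS; lmod K. Qed.

Lemma contr_contr_dif1 u w (f : cochain L M 1) :
  contr u (contr w (dif f)) = contr u (lieder w f) - lieder u (contr w f).
Proof. by rewrite contr_difS linearB /= contr_dif0. Qed.

Lemma lieder_dif k u (f : cochain L M k) : lieder u (dif f) = dif (lieder u f).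
Proof.
elim: k u f => [|k IH] u f; apply: contr_ext => w.
  by rewrite contr_lieder !contr_dif0 lieder_lieder addrK.
rewrite contr_lieder !contr_difS !linearB /= IH lieder_lieder contr_lieder.
by rewrite linearB /=; lmod K.
Qed.

Lemma cocycleP k (f : cochain L M k) : is_cocycle rho f <-> dif f = 0.
Proof.
split=> [[_ df]|df]; first exact/val_inj.
by split; [exact: cochain_alt | rewrite -difE df].
Qed.
End Differential.

Section PullDif.
Variables (K : fieldType) (L1 L2 : lieAlgType K) (M1 M2 : lmodType K).
Variables (rho1 : lieRep L1 M1) (rho2 : lieRep L2 M2).
Variables (phi : {linear L2 -> L1}) (P : {linear M1 -> M2}).
Hypothesis phi_lie : forall x y, phi (lie x y) = lie (phi x) (phi y).
Hypothesis P_rep : forall x m, P (rho1 (phi x) m) = rho2 x (P m).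

Lemma pull_dif k (f : cochain L1 M1 k) :
  pull phi (post P (dif rho1 f)) = dif rho2 (pull phi (post P f)).
Proof.
have lied u j (g : cochain L1 M1 j) :
    pull phi (post P (lieder rho1 (phi u) g)) = lieder rho2 u (pull phi (post P g)).
  rewrite !liederE !linearB /= post_sub (@pull_sub _ _ _ _ _ _ (lie u)); last exact: phi_lie.
  by congr (_ - _); apply/cochainP => v; rewrite pullE !postE /= P_rep.
elim: k f => [|k IH] f; apply: contr_ext => u; rewrite contr_pull contr_post.
  by rewrite !contr_dif0 lied.
by rewrite !contr_difS !linearB /= IH lied contr_pull contr_post.
Qed.
End PullDif.

(** * Derivations of the symmetric algebra *)

Section Derivation.
Variables (K : fieldType) (V : vectType K).
Implicit Types (p q : sym_alg V).

(** The derivation extending [tau]; [sym_act x] is the case [tau = lie x]. Only the values of [tau]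
    on the basis enter, so [tau] may be an unbundled function. *)
Definition der (tau : V -> V) p : sym_alg V :=
  locked (\sum_(i < \dim {:V}) mderiv i p * sym_inj (tau (vbasis fullv)`_i)).

Lemma derE tau p :
  der tau p = \sum_(i < \dim {:V}) mderiv i p * sym_inj (tau (vbasis fullv)`_i).
Proof. by rewrite /der -lock. Qed.

Fact der_is_linear tau : linear (der tau).
Proof.
move=> a p q; rewrite !derE scaler_sumr -big_split /=.
by apply: eq_bigr => i _; rewrite linearP mulrDl scalerAl.
Qed.
HB.instance Definition _ tau :=
  GRing.isLinear.Build K (sym_alg V) (sym_alg V) *:%R (der tau) (der_is_linear tau).

Lemma derM tau p q : der tau (p * q) = der tau p * q + p * der tau q.
Proof.
rewrite !derE mulr_suml mulr_sumr -big_split /=.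
by apply: eq_bigr => i _; rewrite mderivM mulrDl mulrAC mulrA.
Qed.

Lemma derA tau (c : K) : der tau c%:A = 0.
Proof.
rewrite linearZ /= derE big1 ?scaler0 // => i _.
by rewrite -mpolyC1 mderivC mul0r.
Qed.

Lemma der_inj (tau : {linear V -> V}) v : der tau (sym_inj v) = sym_inj (tau v).
Proof.
rewrite [v in RHS](coord_vbasis (memvf v)) !linear_sum.
apply: eq_bigr => i _ /=; rewrite !linearZ /=; congr (_ *: _).
rewrite !derE (bigD1 i) //= mderivX mnm1E eqxx -[X in (X - _)%MM]add0m addmK.
rewrite mpolyX0 scale1r mul1r big1 ?addr0 // => j nji.
by rewrite mderivX mnm1E eq_sym (negbTE nji) scale0r mul0r.
Qed.

Lemma der_eq (t1 t2 : V -> V) p : t1 =1 t2 -> der t1 p = der t2 p.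
Proof. by move=> E; rewrite !derE; apply: eq_bigr => i _; rewrite E. Qed.

Lemma der_comb (t t1 t2 : V -> V) a p :
  (forall y, t y = a *: t1 y + t2 y) -> der t p = a *: der t1 p + der t2 p.
Proof.
move=> E; rewrite !derE scaler_sumr -big_split /=.
by apply: eq_bigr => i _; rewrite E linearP mulrDr scalerAr.
Qed.

Lemma der_null (t : V -> V) p : (forall y, t y = 0) -> der t p = 0.
Proof. by move=> E; rewrite !derE big1 // => i _; rewrite E linear0 mulr0. Qed.

Lemma der_comm (t1 t2 t : {linear V -> V}) p :
  (forall y, t y = t1 (t2 y) - t2 (t1 y)) ->
  der t1 (der t2 p) = der t2 (der t1 p) + der t p.
Proof.
move=> E; elim/sym_ind: p => [c|v|p q Hp Hq|p q Hp Hq].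
- by rewrite !derA !linear0 addr0.
- by rewrite !der_inj E linearB addrC subrK.
- by rewrite !linearD /= Hp Hq; lmod K.
- by rewrite !derM !linearD /= !derM Hp Hq; ring.
Qed.

(* A differential operator of order two without constant term is determined by
   its values on generators and on products of two generators. *)
Lemma der_second_order (I : finType) (c : I -> K) (s t : I -> {linear V -> V})
    (w : {linear V -> V}) :
  (forall y, \sum_i c i *: s i (t i y) = w y) ->
  (forall y z, \sum_i c i *: (sym_inj (s i y) * sym_inj (t i z) +
                              sym_inj (t i y) * sym_inj (s i z)) = 0 :> sym_alg V) ->
  forall p, \sum_i c i *: der (s i) (der (t i) p) = der w p.
Proof.
move=> st_w st0.
(* [G p q] is the failure of the operator to satisfy the Leibniz rule on [p * q]. It is a derivation
   in each argument, so it vanishes as soon as it does on generators. *)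
pose G p q := \sum_i c i *: (der (s i) p * der (t i) q + der (t i) p * der (s i) q).
have GC p q : G p q = G q p.
  by apply: eq_bigr => i _; rewrite addrC mulrC [X in _ + X]mulrC.
have G0 p a : G p a%:A = 0.
  by rewrite /G big1 // => i _; rewrite !derA !mulr0 addr0 scaler0.
have GD p q r : G p (q + r) = G p q + G p r.
  rewrite /G -big_split; apply: eq_bigr => i _ /=; rewrite -scalerDr.
  by congr (_ *: _); rewrite !linearD /=; ring.
have GM p q r : G p (q * r) = G p q * r + q * G p r.
  rewrite /G mulr_suml mulr_sumr -big_split; apply: eq_bigr => i _ /=.
  by rewrite -scalerAl -scalerAr -scalerDr; congr (_ *: _); rewrite !derM; ring.
have {st0} G_eq0 p q : G p q = 0.
  elim/sym_ind: p => [a|v|p r Hp Hr|p r Hp Hr]; first by rewrite GC G0.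
  - elim/sym_ind: q => [a|z|q r Hq Hr|q r Hq Hr]; first exact: G0.
    + by rewrite -[RHS](st0 v z); apply: eq_bigr => i _; rewrite !der_inj.
    + by rewrite GD Hq Hr addr0.
    + by rewrite GM Hq Hr mul0r mulr0 addr0.
  - by rewrite GC GD ![G q _]GC Hp Hr addr0.
  - by rewrite GC GM ![G q _]GC Hp Hr mul0r mulr0 addr0.
move=> p; elim/sym_ind: p => [a|v|p q Hp Hq|p q Hp Hq].
- by rewrite derA big1 // => i _; rewrite derA linear0 scaler0.
- rewrite der_inj -st_w linear_sum; apply: eq_bigr => i _ /=.
  by rewrite !der_inj linearZ.
- rewrite !linearD /= -Hp -Hq -big_split; apply: eq_bigr => i _ /=.
  by rewrite !linearD.
rewrite derM -Hp -Hq -[RHS]addr0 -[X in _ = _ + X](G_eq0 p q) mulr_suml mulr_sumr.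
rewrite -!big_split /=; apply: eq_bigr => i _.
by rewrite -scalerAl -scalerAr -!scalerDr; congr (_ *: _); rewrite derM linearD /= !derM; ring.
Qed.

Definition aug p : K^o := p@_0%MM.

Fact aug_is_linear : linear aug.
Proof. by move=> a p q; rewrite /aug linearP. Qed.
HB.instance Definition _ :=
  GRing.isLinear.Build K (sym_alg V) K^o *:%R aug aug_is_linear.

Lemma augA (c : K) : aug c%:A = c.
Proof. by rewrite /aug mcoeffZ mcoeff1 eqxx mulr1. Qed.

Lemma aug_der tau p : aug (der tau p) = 0.
Proof.
have aug_inj v : aug (sym_inj v) = 0.
  rewrite /aug /sym_inj linear_sum big1 //= => j _.
  by rewrite mcoeffZ mcoeffX mnm1_eq0 mulr0.
rewrite !derE linear_sum big1 //= => i _; rewrite /aug rmorphM /=.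
by rewrite [X in _ * X]aug_inj mulr0.
Qed.

Lemma euler_coef p m : (der idfun p)@_m = (mdeg m)%:R * p@_m.
Proof.
rewrite [p in LHS](mpolyE (p : {mpoly K[_]})) [p in RHS](mpolyE (p : {mpoly K[_]})).
rewrite !linear_sum mulr_sumr; apply: eq_bigr => n _ /=.
rewrite linearZ /= !mcoeffZ mulrCA; congr (_ * _).
have E i : mderiv i 'X_[n] * sym_inj (vbasis fullv)`_i = 'X_[n] *+ n i :> sym_alg V.
  rewrite sym_inj_basis mderivX -scalerAl -mpolyXD.
  (* If the exponent is 0, the truncated subtraction of multi-indices is not undone by the product,
     but the coefficient vanishes. *)
  have [->|ni] := eqVneq (n i) 0%N; first by rewrite scale0r.
  by rewrite submK ?lep1mP // scaler_nat.
rewrite !derE (eq_bigr _ (fun i _ => E i)) sumrMnr -mdegE mcoeffMn mcoeffX.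
by case: eqP => [->|_]; rewrite ?mul0rn ?mulr0 // mulr1.
Qed.

(* [1 / (mdeg m)%:R] is [0] for [m = 0]. *)
Definition euler_inv p : sym_alg V :=
  \sum_(m <- msupp (p : {mpoly K[_]})) (p@_m / (mdeg m)%:R) *: 'X_[m].

Lemma euler_inv_coef p m : (euler_inv p)@_m = p@_m / (mdeg m)%:R.
Proof.
rewrite /euler_inv linear_sum /=.
have [mp|mp] := boolP (m \in msupp (p : {mpoly K[_]})).
  rewrite (bigD1_seq m) ?msupp_uniq //= mcoeffZ mcoeffX eqxx mulr1 big1 ?addr0 // => n nm.
  by rewrite mcoeffZ mcoeffX (negbTE nm) mulr0.
rewrite (memN_msupp_eq0 mp) mul0r big_seq big1 // => n np.
by rewrite mcoeffZ mcoeffX; case: eqP => [nm|]; rewrite ?mulr0 //; rewrite -nm np in mp.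
Qed.

Fact euler_inv_is_linear : linear euler_inv.
Proof.
move=> a p q; apply/mpolyP => m.
by rewrite linearP /= !euler_inv_coef linearP /= mulrDl mulrA.
Qed.
HB.instance Definition _ :=
  GRing.isLinear.Build K (sym_alg V) (sym_alg V) *:%R euler_inv euler_inv_is_linear.

Hypothesis charK : [pchar K] =i pred0.

Lemma euler_invK p : der idfun (euler_inv p) = p - (aug p)%:A.
Proof.
apply/mpolyP => m; rewrite euler_coef euler_inv_coef linearB /= mcoeffZ mcoeff1 mulrCA.
have [m0|m0] := eqVneq m 0%MM; first by rewrite m0 mdeg0 mul0r mulr0 mulr1 subrr.
rewrite mulr0 subr0 mulfV ?mulr1 //.
by rewrite (pcharf0P K).1 // mdeg_eq0.
Qed.

Lemma eulerK p : euler_inv (der idfun p) = p - (aug p)%:A.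
Proof.
rewrite -euler_invK; apply/mpolyP => m.
by rewrite !(euler_coef, euler_inv_coef) mulrA.
Qed.

(** [der tau] preserves the degree: it commutes with the Euler operator because [tau] commutes with
    the identity, and its values have no constant term. *)
Lemma euler_inv_der (tau : {linear V -> V}) p :
  euler_inv (der tau p) = der tau (euler_inv p).
Proof.
have -> : der tau p = der tau (der idfun (euler_inv p)).
  by rewrite euler_invK linearB /= derA subr0.
rewrite (@der_comm _ _ \0) => [|y]; last by rewrite subrr.
rewrite (@der_null \0) // addr0 eulerK aug_der scale0r subr0 //.
Qed.
End Derivation.

(** * The invariant tensor of [gl_m], the sum of the [E_ij] tensor [E_ji] *)

Section Casimir.
Variables (K : fieldType) (m : nat).
Local Notation gl := (gl_lie K m).
Local Notation vec := (vec_lie K m).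

Lemma linear_comb (U W : lmodType K) (f : U -> W) : linear f ->
  forall I (r : seq I) (a : I -> K) (x : I -> U),
  f (\sum_(i <- r) a i *: x i) = \sum_(i <- r) a i *: f (x i).
Proof.
move=> fL I r a x; pose F : {linear U -> W} := HB.pack f (GRing.isLinear.Build K U W _ f fL).
by rewrite -[f]/(F : U -> W) linear_sum; apply: eq_bigr => i _; rewrite linearZ.
Qed.

Lemma linear_sub (U W : lmodType K) (f : U -> W) : linear f ->
  forall x y, f (x - y) = f x - f y.
Proof.
move=> fL x y; pose F : {linear U -> W} := HB.pack f (GRing.isLinear.Build K U W _ f fL).
exact: (linearB F).
Qed.

Lemma linear_opp (U W : lmodType K) (f : U -> W) : linear f -> forall x, f (- x) = - f x.
Proof.
move=> fL x; pose F : {linear U -> W} := HB.pack f (GRing.isLinear.Build K U W _ f fL).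
exact: (linearN F).
Qed.

Lemma linear_scale (U W : lmodType K) (f : U -> W) : linear f ->
  forall a x, f (a *: x) = a *: f x.
Proof.
move=> fL a x; pose F : {linear U -> W} := HB.pack f (GRing.isLinear.Build K U W _ f fL).
by rewrite -[f]/(F : U -> W) linearZ.
Qed.

Definition gl_basis (p : 'I_m * 'I_m) : gl := delta_mx p.1 p.2.
Definition gl_dual (p : 'I_m * 'I_m) : gl := delta_mx p.2 p.1.
Definition vec_basis (a : 'I_m) : vec := delta_mx a 0.

Lemma mulmx_delta n n' (x : 'M[K]_(n, m)) i (j : 'I_n') :
  x *m delta_mx i j = \sum_k x k i *: delta_mx k j.
Proof.
apply/matrixP => a b; rewrite !mxE summxE (bigD1 i) //= big1 => [|c nc].
  rewrite addr0 (bigD1 a) //= big1 => [|c nc]; first by rewrite !mxE !eqxx addr0.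
  by rewrite !mxE eq_sym (negbTE nc) mulr0.
by rewrite mxE (negbTE nc) mulr0.
Qed.

Lemma delta_mulmx n n' (x : 'M[K]_(m, n)) (i : 'I_n') (j : 'I_m) :
  delta_mx i j *m x = \sum_k x j k *: delta_mx i k.
Proof.
apply/matrixP => a b; rewrite !mxE summxE (bigD1 j) //= big1 => [|c nc].
  rewrite addr0 (bigD1 b) //= big1 => [|c nc].
    by rewrite !mxE !eqxx andbT addr0 mulrC.
  by rewrite !mxE [b == c]eq_sym (negbTE nc) andbF mulr0.
by rewrite mxE (negbTE nc) andbF mul0r.
Qed.

Section Bilinear.
Variables (W : lmodType K) (Psi : gl -> gl -> W).
Hypotheses (linl : forall b, linear (Psi^~ b)) (linr : forall a, linear (Psi a)).

(** Both sides expand to the sum of [x_ki Psi(E_kj, E_ji)] over all indices. *)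
Lemma casimir_l (x : gl) :
  \sum_p Psi (x *m gl_basis p) (gl_dual p) = \sum_p Psi (gl_basis p) (gl_dual p *m x).
Proof.
rewrite -(pair_bigA _ (fun i j => Psi (x *m delta_mx i j) (delta_mx j i))).
rewrite -(pair_bigA _ (fun i j => Psi (delta_mx i j) (delta_mx j i *m x))) /=.
rewrite exchange_big [RHS]exchange_big /=; apply: eq_bigr => j _.
under eq_bigr => i _ do rewrite mulmx_delta (linear_comb (linl _)).
under [RHS]eq_bigr => i _ do rewrite delta_mulmx (linear_comb (linr _)).
by rewrite exchange_big.
Qed.

Lemma sum_dual (F : gl -> gl -> W) :
  \sum_p F (gl_basis p) (gl_dual p) = \sum_p F (gl_dual p) (gl_basis p).
Proof.
rewrite -(pair_bigA _ (fun i j => F (delta_mx i j) (delta_mx j i))).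
by rewrite exchange_big pair_bigA.
Qed.
End Bilinear.

Lemma casimir_r (W : lmodType K) (Psi : gl -> gl -> W) (x : gl) :
  (forall b, linear (Psi^~ b)) -> (forall a, linear (Psi a)) ->
  \sum_p Psi (gl_basis p *m x) (gl_dual p) = \sum_p Psi (gl_basis p) (x *m gl_dual p).
Proof.
move=> linl linr.
rewrite (sum_dual (fun a b => Psi (a *m x) b)) (sum_dual (fun a b => Psi a (x *m b))).
exact/esym/(@casimir_l _ (fun a b => Psi b a)).
Qed.

(** Invariance of the tensor under the adjoint action; it makes operators built by pairing the dual
    bases commute with [gl_m]. *)
Lemma casimir_ad (W : lmodType K) (Psi : gl -> gl -> W) (x : gl) :
  (forall b, linear (Psi^~ b)) -> (forall a, linear (Psi a)) ->
  \sum_p Psi (lie x (gl_basis p)) (gl_dual p) = - \sum_p Psi (gl_basis p) (lie x (gl_dual p)).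
Proof.
move=> linl linr.
rewrite /lie /= /gl_bracket; under eq_bigr do rewrite (linear_sub (linl _)).
under [X in - X]eq_bigr do rewrite (linear_sub (linr _)).
by rewrite !sumrB casimir_l // casimir_r // opprB.
Qed.

(** On two copies of [K^m] the tensor acts as the flip. *)
Lemma casimir_vec (W : lmodType K) (Psi : vec -> vec -> W) v w :
  (forall b, linear (Psi^~ b)) -> (forall a, linear (Psi a)) ->
  \sum_p Psi (gl_basis p *m v) (gl_dual p *m w) = Psi w v.
Proof.
move=> linl linr.
rewrite -(pair_bigA _ (fun i j => Psi (delta_mx i j *m v) (delta_mx j i *m w))) /=.
have E (x : vec) : x = \sum_j x j 0 *: vec_basis j.
  by rewrite [LHS]matrix_sum_delta; apply: eq_bigr => j _; rewrite big_ord1.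
rewrite [in RHS](E w) (linear_comb (linl _)); apply: eq_bigr => i _.
rewrite [in RHS](E v) (linear_comb (linr _)) scaler_sumr; apply: eq_bigr => j _.
have D (k l : 'I_m) (x : vec) : delta_mx k l *m x = x l 0 *: vec_basis k.
  by rewrite delta_mulmx big_ord1.
by rewrite !D (linear_scale (linl _)) (linear_scale (linr _)) !scalerA mulrC.
Qed.

(** Trades a sum over the basis of [gl_m] for one over the basis of [K^m]: both are the sum of
    [u_i Psi(E_ij, e_j)]. *)
Lemma casimir_gl_vec (W : lmodType K) (Psi : gl -> vec -> W) u :
  (forall b, linear (Psi^~ b)) -> (forall a, linear (Psi a)) ->
  \sum_p Psi (gl_basis p) (gl_dual p *m u) = \sum_j Psi (u *m delta_mx 0 j) (vec_basis j).
Proof.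
move=> linl linr.
rewrite -(pair_bigA _ (fun i j => Psi (delta_mx i j) (delta_mx j i *m u))) /=.
rewrite exchange_big; apply: eq_bigr => j _.
rewrite (_ : u *m _ = \sum_i u i 0 *: delta_mx i j); last first.
  apply/matrixP => a b; rewrite !mxE big_ord1 summxE (bigD1 a) //= big1 => [|c nc].
    by rewrite !mxE !eqxx addr0.
  by rewrite !mxE eq_sym (negbTE nc) mulr0.
rewrite (linear_comb (linl _)); apply: eq_bigr => i _.
by rewrite delta_mulmx (linear_comb (linr _)) big_ord1.
Qed.

Lemma casimir_trace (x : gl) : \sum_p gl_basis p *m x *m gl_dual p = (\tr x)%:M.
Proof.
rewrite -(pair_bigA _ (fun i j => delta_mx i j *m x *m delta_mx j i)) /=.
rewrite -scalemx1 mx1_sum_delta scaler_sumr; apply: eq_bigr => i _.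
rewrite /mxtrace scaler_suml; apply: eq_bigr => j _.
rewrite delta_mulmx mulmx_suml (bigD1 j) //= big1 ?addr0 => [|k kj].
  by rewrite -scalemxAl mul_delta_mx.
by rewrite -scalemxAl mul_delta_mx_cond (negbTE kj) mulr0n scaler0.
Qed.

Lemma casimir_mul : \sum_p gl_basis p *m gl_dual p = (m%:R)%:M :> gl.
Proof.
have := casimir_trace 1%:M; rewrite mxtrace1 => <-.
by apply: eq_bigr => p _; rewrite mulmx1.
Qed.
End Casimir.

Ltac bilin := let c := fresh in let x := fresh in let y := fresh in
  move=> ? c x y; rewrite /= ?mulmxDr ?mulmxDl -?scalemxAr -?scalemxAl ?mulmxDr ?mulmxDl
    -?scalemxAr -?scalemxAl ?linearP /= ?mulrDl ?mulrDr -?scalerAl -?scalerAr.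

(** * The Euler homotopy *)

Section Euler.
Variables (K : fieldType) (m : nat).
Local Notation gl := (gl_lie K m).
Local Notation vec := (vec_lie K m).
(* The canonical structure rather than its carrier, so that all the coercions to
   weaker structures are elaborated in the same way. *)
Local Notation aff := (Defs_aff_lie__canonical__Defs_LieAlgebra K m).
Local Notation S := (sym_alg aff).

(* Left multiplication by [x] is half the sum of [aff_sym x] and the adjoint action. *)
Definition aff_sym (x : gl) (y : aff) : aff := (x *m y.1 + y.1 *m x, x *m y.2).
Definition aff_tr (x : gl) (y : aff) : aff := (0, x *m y.2).
(** For the [a]-th unit row it sends [y_b] to [x_ba]; its derivation composed with the contraction
    along [y_a], summed over [a], is the operator [H]. *)
Definition aff_mu (r : 'rV[K]_m) (y : aff) : aff := (y.2 *m r, 0).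
Definition aff_id : aff := gl_aff 1%:M.

Fact aff_sym_is_linear x : linear (aff_sym x).
Proof.
move=> a y z; congr (_, _) => /=; rewrite !mulmxDr -!scalemxAr // mulmxDl -scalemxAl.
by rewrite scalerDr addrACA.
Qed.
HB.instance Definition _ x :=
  GRing.isLinear.Build K aff aff *:%R (aff_sym x) (aff_sym_is_linear x).

Fact aff_tr_is_linear x : linear (aff_tr x).
Proof.
by move=> a y z; congr (_, _) => /=; rewrite ?scaler0 ?addr0 // mulmxDr -scalemxAr.
Qed.
HB.instance Definition _ x :=
  GRing.isLinear.Build K aff aff *:%R (aff_tr x) (aff_tr_is_linear x).

Fact aff_mu_is_linear r : linear (aff_mu r).
Proof.
by move=> a y z; congr (_, _) => /=; rewrite ?scaler0 ?addr0 // mulmxDl -scalemxAl.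
Qed.
HB.instance Definition _ r :=
  GRing.isLinear.Build K aff aff *:%R (aff_mu r) (aff_mu_is_linear r).

Fact gl_aff_is_linear : linear (@gl_aff K m).
Proof. by move=> a u v; congr (_, _); rewrite /= scaler0 addr0. Qed.
HB.instance Definition _ :=
  GRing.isLinear.Build K gl aff *:%R (@gl_aff K m) gl_aff_is_linear.

Lemma aff_split (y : aff) : y = gl_aff y.1 + vec_aff y.2.
Proof. by case: y => x v; congr (_, _); rewrite /= ?addr0 ?add0r. Qed.

Lemma lie_vec_aff v (y : aff) : lie (vec_aff v) y = vec_aff (- (y.1 *m v)).
Proof. by congr (_, _) => /=; rewrite ?lie0x // mul0mx sub0r. Qed.
Lemma lie_gl_aff x (y : aff) : lie (gl_aff x) y = gl_aff (lie x y.1) + vec_aff (x *m y.2).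
Proof. by congr (_, _) => /=; rewrite ?addr0 // mulmx0 subr0 add0r. Qed.
Lemma lie_aff_id (y : aff) : lie aff_id y = vec_aff y.2.
Proof.
rewrite lie_gl_aff mul1mx (_ : lie _ _ = 0) ?linear0 ?add0r //.
by rewrite /lie /= /gl_bracket mul1mx mulmx1 subrr.
Qed.

Lemma sym_actE (x : aff) (p : S) : sym_act x p = der (lie x) p.
Proof. by rewrite derE. Qed.

(** The first order part of the three quadratic families together: 2 on [gl_m] and [1 - m] on
    [K^m]. *)
Definition euler_weight (y : aff) : aff := 2 *: y - (m%:R + 1) *: lie aff_id y.
Fact euler_weight_is_linear : linear euler_weight.
Proof. move=> a y z; rewrite /euler_weight lieDr lieZr; lmod K. Qed.
HB.instance Definition _ :=
  GRing.isLinear.Build K aff aff *:%R euler_weight euler_weight_is_linear.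

(** Indexes the quadratic terms: those of [H], the Casimir-like ones of [gl_m], and the square of
    the identity matrix. *)
Let I := ('I_m + 'I_m * 'I_m + unit)%type.
Let c (i : I) : K := match i with
  | inl (inl _) => - 2 | inl (inr _) => -1 | inr _ => 1 end.
Let s (i : I) : {linear aff -> aff} := match i with
  | inl (inl a) => aff_mu (delta_mx 0 a)
  | inl (inr p) => aff_sym (gl_basis K p)
  | inr _ => lie aff_id end.
Let t (i : I) : {linear aff -> aff} := match i with
  | inl (inl a) => lie (vec_aff (vec_basis K a))
  | inl (inr p) => lie (gl_aff (gl_dual K p))
  | inr _ => lie aff_id end.

Let sum_I (W : nmodType) (F : I -> W) : \sum_i F i =
  \sum_a F (inl (inl a)) + \sum_p F (inl (inr p)) + F (inr tt).
Proof.
rewrite big_sumType big_sumType /=; congr (_ + _).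
by rewrite (bigD1 tt) //= big1 ?addr0 // => -[].
Qed.

Lemma lie_gl (x y : gl) : lie x y = x *m y - y *m x.
Proof. by []. Qed.

Lemma aff_muE r x v : aff_mu r (gl_aff x + vec_aff v) = gl_aff (v *m r).
Proof. by congr (_, _) => //=; rewrite add0r. Qed.
Lemma aff_symE g x v :
  aff_sym g (gl_aff x + vec_aff v) = gl_aff (g *m x + x *m g) + vec_aff (g *m v).
Proof. by congr (_, _) => /=; rewrite ?addr0 ?add0r. Qed.

Lemma sum_dual_mul (x : gl) : \sum_p gl_dual K p *m x *m gl_basis K p = (\tr x)%:M.
Proof. by rewrite -(sum_dual (fun a b => a *m x *m b)) casimir_trace. Qed.

Lemma sum_mul_dual : \sum_p gl_dual K p *m gl_basis K p = (m%:R)%:M :> gl.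
Proof. by rewrite -(sum_dual (fun a b => a *m b)) casimir_mul. Qed.

Let st_weight y : \sum_i c i *: s i (t i y) = euler_weight y.
Proof.
rewrite sum_I /= -!scaler_sumr.
have -> : \sum_a aff_mu (delta_mx 0 a) (lie (vec_aff (vec_basis K a)) y) = - gl_aff y.1.
  under eq_bigr do rewrite lie_vec_aff -[vec_aff _]add0r -(linear0 (@gl_aff K m)) aff_muE.
  rewrite -linear_sum -linearN /=; congr gl_aff.
  rewrite -[y.1 in RHS]mulmx1 mx1_sum_delta mulmx_sumr -sumrN; apply: eq_bigr => a _.
  by rewrite mulNmx -mulmxA mul_delta_mx.
have -> : \sum_p aff_sym (gl_basis K p) (lie (gl_aff (gl_dual K p)) y) = m%:R *: vec_aff y.2.
  under eq_bigr do rewrite lie_gl_aff aff_symE.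
  rewrite big_split /= -!linear_sum /= -[RHS]add0r; congr (_ + _); last first.
    under eq_bigr do rewrite mulmxA.
    by rewrite -mulmx_suml casimir_mul mul_scalar_mx linearZ.
  rewrite -(linear0 (@gl_aff K m)); congr gl_aff.
  rewrite /lie /= /gl_bracket; under eq_bigr do rewrite mulmxBr mulmxBl !mulmxA.
  rewrite big_split /= !sumrB casimir_trace sum_dual_mul -!mulmx_suml casimir_mul.
  under [X in _ + (_ - X)]eq_bigr do rewrite -mulmxA.
  rewrite -mulmx_sumr sum_mul_dual.
  by rewrite mul_scalar_mx mul_mx_scalar addrA subrK subrr.
rewrite /euler_weight !lie_aff_id [y in 2 *: y](aff_split y) /=; lmod K.
Qed.

Let X (x : gl) : S := sym_inj (gl_aff x).
Let X_lin : linear X.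
Proof. by move=> a x y; rewrite /X !linearP. Qed.
HB.instance Definition _ := GRing.isLinear.Build K gl S *:%R X X_lin.
Let Y (v : vec) : S := sym_inj (vec_aff v).
Let Y_lin : linear Y.
Proof. by move=> a x y; rewrite /Y !linearP. Qed.
HB.instance Definition _ := GRing.isLinear.Build K vec S *:%R Y Y_lin.

(** Left and right multiplications contribute equally since the symmetric algebra is commutative;
    this removes the pure [gl_m] part of the symbol. *)
Let XX x z : \sum_p X (gl_basis K p *m x) * X (gl_dual K p *m z) =
             \sum_p X (x *m gl_basis K p) * X (z *m gl_dual K p).
Proof.
rewrite (sum_dual (fun a b => X (a *m x) * X (b *m z))).
rewrite (@casimir_l _ _ _ (fun a b => X a * X (z *m b))); try by bilin.
under [RHS]eq_bigr do rewrite mulmxA.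
rewrite -(@casimir_r _ _ _ (fun a b => X a * X (b *m x))); try by bilin.
by apply: eq_bigr => p _; rewrite mulrC.
Qed.

Let XY x w : \sum_p X (gl_basis K p *m x) * Y (gl_dual K p *m w) =
             \sum_a X (w *m delta_mx 0 a) * Y (x *m vec_basis K a).
Proof.
rewrite (@casimir_r _ _ _ (fun a b => X a * Y (b *m w))); try by bilin.
under eq_bigr do rewrite -mulmxA.
by rewrite (@casimir_gl_vec _ _ _ (fun a b => X a * Y (x *m b))); try by bilin.
Qed.

(** The family of [H] contributes the terms mixing [X] and [Y]. The Casimir family takes them back
    and subtracts twice [Y v * Y w], which the square of the identity matrix restores. *)
Let st_null y z : \sum_i c i *: (sym_inj (s i y) * sym_inj (t i z) +
                                 sym_inj (t i y) * sym_inj (s i z)) = 0 :> S.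
Proof.
rewrite (aff_split y) (aff_split z); move: y.1 y.2 z.1 z.2 => {y z} x v z w.
rewrite sum_I /= -!scaler_sumr.
have -> : \sum_a (sym_inj (aff_mu (delta_mx 0 a) (gl_aff x + vec_aff v)) *
    sym_inj (lie (vec_aff (vec_basis K a)) (gl_aff z + vec_aff w)) +
    sym_inj (lie (vec_aff (vec_basis K a)) (gl_aff x + vec_aff v)) *
    sym_inj (aff_mu (delta_mx 0 a) (gl_aff z + vec_aff w))) =
    - \sum_p X (gl_basis K p *m z) * Y (gl_dual K p *m v)
    - \sum_p X (gl_basis K p *m x) * Y (gl_dual K p *m w).
  rewrite !XY big_split /= -!sumrN; congr (_ + _); apply: eq_bigr => a _.
    by rewrite aff_muE lie_vec_aff /= addr0 !linearN mulrN.
  by rewrite aff_muE lie_vec_aff /= addr0 !linearN mulNr mulrC.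
set F := (X in _ + -1 *: X + _).
have {F} -> : F = \sum_p X (gl_basis K p *m z) * Y (gl_dual K p *m v) *+ 2
    + \sum_p X (gl_basis K p *m x) * Y (gl_dual K p *m w) *+ 2 + Y v * Y w *+ 2.
  pose G g d : S := (X (g *m x) + X (x *m g) + Y (g *m v)) *
    (X (d *m z) - X (z *m d) + Y (d *m w)).
  pose H g d : S := (X (d *m x) - X (x *m d) + Y (d *m v)) *
    (X (g *m z) + X (z *m g) + Y (g *m w)).
  have -> : F = \sum_p G (gl_basis K p) (gl_dual K p) + \sum_p H (gl_basis K p) (gl_dual K p).
    rewrite /F -big_split; apply: eq_bigr => p _ /=.
    by rewrite !aff_symE !lie_gl_aff !lie_gl /= !addr0 !add0r !linearD /= !linearN.
  (* With the dual bases exchanged in the second sum, the products mixing a left with a right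
     multiplication cancel termwise, and [T] is left. *)
  rewrite (sum_dual H) -big_split /=.
  pose T g d : S := (X (g *m x) * X (d *m z)) *+ 2 - (X (x *m g) * X (z *m d)) *+ 2
    + (X (d *m z) * Y (g *m v)) *+ 2 + (X (g *m x) * Y (d *m w)) *+ 2
    + (Y (g *m v) * Y (d *m w)) *+ 2.
  rewrite (eq_bigr (fun p => T (gl_basis K p) (gl_dual K p))) => [|p _]; last first.
    by rewrite /G /H /T; ring.
  rewrite /T !big_split /= !sumrN !sumrMnl XX subrr add0r.
  rewrite (sum_dual (fun g d => X (d *m z) * Y (g *m v))).
  rewrite (@casimir_vec _ _ _ (fun a b => Y a * Y b)); try by bilin.
  by rewrite [Y w * _]mulrC.
rewrite !lie_aff_id /= !add0r -/(Y v) -/(Y w).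
rewrite !sumrMnl.
set P := \sum_p _; set Q := \sum_p _; set R := Y v * _; lmod K.
Qed.

Lemma euler_second_order (p : S) :
  -2 *: (\sum_a der (aff_mu (delta_mx 0 a)) (sym_act (vec_aff (vec_basis K a)) p))
  - \sum_q der (aff_sym (gl_basis K q)) (sym_act (gl_aff (gl_dual K q)) p)
  + sym_act aff_id (sym_act aff_id p) + (m%:R + 1) *: sym_act aff_id p
  = 2 *: der idfun p.
Proof.
have := der_second_order st_weight st_null p; rewrite sum_I /= -!scaler_sumr.
rewrite (@der_comb _ _ euler_weight (lie aff_id) (fun y => 2 *: y) (- (m%:R + 1))); last first.
  by move=> y; rewrite /euler_weight addrC scaleNr.
rewrite (@der_comb _ _ (fun y => 2 *: y) idfun (fun=> 0) 2); last first.
  by move=> y; rewrite addr0.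
rewrite [der (fun=> 0) p]der_null // addr0 => E.
apply: (addrI (- (m%:R + 1) *: der (lie aff_id) p)); rewrite -E !sym_actE.
under eq_bigr do rewrite sym_actE.
under [X in _ - X]eq_bigr do rewrite sym_actE.
by rewrite scale1r scaleN1r scaleNr [LHS]addrC addrK.
Qed.
End Euler.

(** * The homotopy, its contractions and its [gl_m]-invariance *)

Section Homotopy.
Variables (K : fieldType) (m : nat).
Local Notation gl := (gl_lie K m).
Local Notation vec := (vec_lie K m).
Local Notation aff := (Defs_aff_lie__canonical__Defs_LieAlgebra K m).
Local Notation S := (sym_alg aff).
Local Notation C := (cochain aff S).
Local Notation rho := (sym_rep aff).
Local Notation gl_basis := (@gl_basis K m).
Local Notation gl_dual := (@gl_dual K m).
Local Notation vec_basis := (@vec_basis K m).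
Local Notation E := (aff_id K m).

(** On cochains of [K^m] this restricts to twice the left multiplication on coefficients minus the
    action of [x] ([vec_glopE]); [aff_tr] prolongs the action on the arguments by 0 on [gl_m]. *)
Definition glop (x : gl) k (f : C k) : C k :=
  post (der (aff_sym x)) f + sub (aff_tr x) f.

Fact glop_is_linear x k : linear (@glop x k).
Proof. by move=> a f g; rewrite /glop !linearP; lmod K. Qed.
HB.instance Definition _ x k :=
  GRing.isLinear.Build K (C k) (C k) *:%R (@glop x k) (@glop_is_linear x k).

(* Twice the homotopy: [H], the homotopies of the two Casimir terms (combined in
   [gl_op]), and the one of the weights of the identity matrix. *)
Definition euler_hom k (f : C k.+1) : C k := locked (
  -2 *: (\sum_a post (der (aff_mu (delta_mx 0 a))) (contr (vec_aff (vec_basis a)) f))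
  - \sum_p glop (gl_basis p) (contr (gl_aff (gl_dual p)) f)
  + lieder rho E (contr E f) + (m%:R + 1) *: contr E f).

Lemma euler_homE k (f : C k.+1) : euler_hom f =
  -2 *: (\sum_a post (der (aff_mu (delta_mx 0 a))) (contr (vec_aff (vec_basis a)) f))
  - \sum_p glop (gl_basis p) (contr (gl_aff (gl_dual p)) f)
  + lieder rho E (contr E f) + (m%:R + 1) *: contr E f.
Proof. by rewrite /euler_hom -lock. Qed.

Fact euler_hom_is_linear k : linear (@euler_hom k).
Proof.
move=> a f g; rewrite !euler_homE !linearP /=.
have sumP (I : finType) (F : I -> {linear C k.+1 -> C k}) :
    \sum_i F i (a *: f + g) = a *: (\sum_i F i f) + \sum_i F i g.
  by rewrite scaler_sumr -big_split; apply: eq_bigr => i _; rewrite linearP.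
rewrite (sumP _ (fun b => @post _ _ _ _ (der (aff_mu (delta_mx 0 b))) k \o
  contr (vec_aff (vec_basis b)))).
rewrite (sumP _ (fun p => @glop (gl_basis p) k \o contr (gl_aff (gl_dual p)))) /=.
by set A := \sum_b _; set B := \sum_p _; set D := \sum_b _; set H := \sum_p _; lmod K.
Qed.
HB.instance Definition _ k := GRing.isLinear.Build K (C k.+1) (C k) *:%R
  (@euler_hom k) (@euler_hom_is_linear k).

Lemma contr_glop u x k (f : C k.+1) :
  contr u (glop x f) = glop x (contr u f) + contr (aff_tr x u) f.
Proof. by rewrite /glop linearD /= contr_post contr_sub addrA. Qed.

Lemma glop_linearl k (f : C k) : linear (fun x : gl => glop x f).
Proof.
move=> a x y; rewrite /glop.
rewrite (@post_comb _ _ _ _ _ (der (aff_sym x)) (der (aff_sym y)) a); last first.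
  move=> p; apply: der_comb => z; congr (_, _) => /=; last first.
    by rewrite mulmxDl -scalemxAl.
  by rewrite mulmxDl mulmxDr -scalemxAl -scalemxAr scalerDr addrACA.
rewrite (@sub_comb _ _ _ _ (aff_tr x) (aff_tr y) a); first by lmod K.
by move=> z; congr (_, _) => /=; rewrite ?scaler0 ?addr0 // mulmxDl -scalemxAl.
Qed.

(** What a contraction with [u] leaves behind when it passes the argument part of [glop] and the Lie
    derivative along [E]. *)
Definition euler_hom_defect u k (f : C k.+2) : C k :=
  \sum_p contr (aff_tr (gl_basis p) u) (contr (gl_aff (gl_dual p)) f)
  + contr (lie E u) (contr E f).

Lemma contr_euler_hom u k (f : C k.+2) :
  contr u (euler_hom f) = - euler_hom (contr u f) - euler_hom_defect u f.
Proof.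
have E1 : contr u (\sum_a post (der (aff_mu (delta_mx 0 a))) (contr (vec_aff (vec_basis a)) f))
    = - \sum_a post (der (aff_mu (delta_mx 0 a))) (contr (vec_aff (vec_basis a)) (contr u f)).
  rewrite linear_sum -sumrN; apply: eq_bigr => a _ /=.
  by rewrite contr_post contrC linearN.
have E2 : contr u (\sum_p glop (gl_basis p) (contr (gl_aff (gl_dual p)) f)) =
    - \sum_p glop (gl_basis p) (contr (gl_aff (gl_dual p)) (contr u f))
    + \sum_p contr (aff_tr (gl_basis p) u) (contr (gl_aff (gl_dual p)) f).
  rewrite linear_sum -sumrN -big_split; apply: eq_bigr => p _ /=.
  by rewrite contr_glop [contr u (contr _ f)]contrC linearN.
rewrite !euler_homE !linearD /= linearN !linearZ /= E1 E2 contr_lieder.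
rewrite [contr u (contr E f)]contrC [lieder _ _ (- _)]linearN /euler_hom_defect.
set P := \sum_a _; rewrite -/P; set Q := \sum_p _; set R := \sum_p _; lmod K.
Qed.

Lemma lieder_post u (t : {linear aff -> aff}) k (f : C k) :
  lieder rho u (post (der t) f) = post (der t) (lieder rho u f) +
    post (der (fun y => lie u (t y) - t (lie u y))) f.
Proof.
rewrite !liederE linearB /= -post_sub.
rewrite (@post_comm _ _ _ _ _ (der (fun y => lie u (t y) - t (lie u y)))).
  by lmod K.
move=> p; rewrite /= !sym_actE.
exact: (@der_comm _ _ (lie u) t ((lie u \o t) \- (t \o lie u))).
Qed.

Lemma lieder_sub u (t t' : {linear aff -> aff}) k (f : C k) :
  (forall y, t' y = lie u (t y) - t (lie u y)) ->
  lieder rho u (sub t f) = sub t (lieder rho u f) + sub t' f.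
Proof.
move=> t'E; rewrite !liederE linearB /= post_sub.
rewrite [sub t (sub (lie u) f)](@sub_comm _ _ _ _ _ t') //; lmod K.
Qed.

Lemma post_der_eq (t1 t2 : aff -> aff) k (f : C k) :
  t1 =1 t2 -> post (der t1) f = post (der t2) f.
Proof. by move=> E; apply: post_eq => p; apply: der_eq. Qed.

Lemma post_der_comb (t t1 t2 : aff -> aff) a k (f : C k) :
  (forall y, t y = a *: t1 y + t2 y) ->
  post (der t) f = a *: post (der t1) f + post (der t2) f.
Proof. by move=> E; apply: post_comb => p; apply: der_comb. Qed.

(** Invariance of the pairing of rows with columns; it makes [H] commute with [gl_m]. *)
Lemma row_col_dual (W : lmodType K) (Psi : 'rV[K]_m -> vec -> W) (x : gl) :
  (forall b, linear (Psi^~ b)) -> (forall a, linear (Psi a)) ->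
  \sum_a Psi (delta_mx 0 a *m x) (vec_basis a) = \sum_a Psi (delta_mx 0 a) (x *m vec_basis a).
Proof.
move=> linl linr.
under eq_bigr do rewrite delta_mulmx (linear_comb (linl _)).
under [RHS]eq_bigr do rewrite mulmx_delta (linear_comb (linr _)).
exact: exchange_big.
Qed.

Lemma lieder_glop_gl x g k (f : C k) :
  lieder rho (gl_aff x) (glop g f) = glop g (lieder rho (gl_aff x) f) + glop (lie x g) f.
Proof.
rewrite /glop linearD /= lieder_post (@lieder_sub _ _ (aff_tr (lie x g))) => [|y].
  rewrite [post (der (fun y => _)) f](@post_der_eq _ (aff_sym (lie x g))) => [|y].
    by lmod K.
  congr (_, _); rewrite /= !lie_gl.
    by rewrite !mulmxBl !mulmxBr !mulmxDl !mulmxDr !mulmxA; lmod K.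
  by rewrite !mulmx0 !subr0 mulmxBl !mulmxA.
congr (_, _) => /=; first by rewrite !lie_gl mulmx0 mul0mx !subr0.
by rewrite mul0mx mulmx0 !subr0 !lie_gl mulmxBl !mulmxA.
Qed.

Lemma lie_gl_aff_id x : lie (gl_aff x) E = 0.
Proof. by congr (_, _); rewrite /= ?mulmx0 ?subr0 // lie_gl mulmx1 mul1mx subrr. Qed.

Lemma euler_hom_lieder_gl x k (f : C k.+1) :
  lieder rho (gl_aff x) (euler_hom f) = euler_hom (lieder rho (gl_aff x) f).
Proof.
set u := gl_aff x.
have E1 : lieder rho u (\sum_a post (der (aff_mu (delta_mx 0 a))) (contr (vec_aff (vec_basis a)) f))
    = \sum_a post (der (aff_mu (delta_mx 0 a))) (contr (vec_aff (vec_basis a)) (lieder rho u f)).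
  pose Psi r w := post (der (aff_mu r)) (contr (vec_aff w) f).
  have Pl b : linear (Psi^~ b).
    move=> a r r'; apply: post_der_comb => y.
    by congr (_, _) => /=; rewrite ?scaler0 ?addr0 // mulmxDr -scalemxAr.
  have Pr r : linear (Psi r).
    by move=> a b b'; rewrite /Psi linearP contr_linearl linearP.
  transitivity (\sum_a (post (der (aff_mu (delta_mx 0 a)))
      (contr (vec_aff (vec_basis a)) (lieder rho u f)) +
      (Psi (delta_mx 0 a) (x *m vec_basis a) - Psi (delta_mx 0 a *m x) (vec_basis a)))); last first.
    by rewrite big_split /= sumrB row_col_dual // subrr addr0.
  rewrite linear_sum; apply: eq_bigr => a _ /=.
  rewrite lieder_post contr_lieder gl_vec_aff_lie linearB /=.
  rewrite [X in _ + X = _](@post_der_eq _ (aff_mu (- (delta_mx 0 a *m x)))).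
    have := linear_opp (Pl (vec_basis a)) (delta_mx 0 a *m x); rewrite /= /Psi => ->.
    by rewrite /Psi; lmod K.
  move=> y; congr (_, _); rewrite /= ?mulmx0 ?subr0 ?mul0mx ?subrr //.
  by rewrite lie_gl mulmxN !mulmxA; lmod K.
have E2 : lieder rho u (\sum_p glop (gl_basis p) (contr (gl_aff (gl_dual p)) f)) =
    \sum_p glop (gl_basis p) (contr (gl_aff (gl_dual p)) (lieder rho u f)).
  pose Psi a b := glop a (contr (gl_aff b) f).
  have Pl b : linear (Psi^~ b) by exact: glop_linearl.
  have Pr r : linear (Psi r).
    by move=> a b b'; rewrite /Psi linearP contr_linearl linearP.
  transitivity (\sum_p (glop (gl_basis p) (contr (gl_aff (gl_dual p)) (lieder rho u f)) +
      (Psi (lie x (gl_basis p)) (gl_dual p) + Psi (gl_basis p) (lie x (gl_dual p))))); last first.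
    rewrite big_split /= [X in _ + X = _](_ : _ = 0) ?addr0 // big_split /=.
    by apply/eqP; rewrite addr_eq0; apply/eqP; exact: (@casimir_ad _ _ _ Psi x Pl Pr).
  rewrite linear_sum; apply: eq_bigr => p _ /=.
  rewrite lieder_glop_gl contr_lieder linearB /= /Psi.
  rewrite (_ : lie u (gl_aff (gl_dual p)) = gl_aff (lie x (gl_dual p))); first by lmod K.
  by congr (_, _); rewrite /= !mulmx0 subr0.
rewrite !euler_homE !linearD /= linearN !linearZ /= E1 E2 lieder_lieder !contr_lieder.
by rewrite lie_gl_aff_id contr0l lieder0l addr0 subr0.
Qed.
End Homotopy.

(** * A cancellation among the operators on the arguments *)

Section VectorHomotopy.
Variables (K : fieldType) (m : nat).
Local Notation gl := (gl_lie K m).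
Local Notation vec := (vec_lie K m).
Local Notation aff := (Defs_aff_lie__canonical__Defs_LieAlgebra K m).
Local Notation S := (sym_alg aff).
Local Notation C := (cochain aff S).
Local Notation rho := (sym_rep aff).
Local Notation gl_basis := (@gl_basis K m).
Local Notation gl_dual := (@gl_dual K m).
Local Notation vec_basis := (@vec_basis K m).
Local Notation E := (aff_id K m).

(** The commutator of [lie (vec_aff v)] with [aff_tr g]. *)
Definition aff_corner (g : gl) (v : vec) (y : aff) : aff := vec_aff (g *m (y.1 *m v)).
Fact aff_corner_is_linear g v : linear (aff_corner g v).
Proof.
move=> a y z; congr (_, _) => /=; first by rewrite scaler0 addr0.
by rewrite mulmxDl mulmxDr -scalemxAl -scalemxAr.
Qed.
HB.instance Definition _ g v :=
  GRing.isLinear.Build K aff aff *:%R (aff_corner g v) (aff_corner_is_linear g v).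

(** On the [K^m] component of [y] the flip produces two terms [- Phi v w], which the last summand
    compensates. On the [gl_m] component the sums cancel by invariance of the tensor and exchange of
    the dual bases. *)
Lemma alternating_relation (W : lmodType K) (Phi : aff -> aff -> W) v y :
  (forall b, linear (Phi^~ b)) -> (forall a, linear (Phi a)) ->
  (forall a, Phi a a = 0) ->
  \sum_p (Phi (vec_aff (gl_dual p *m v)) (aff_tr (gl_basis p) y) +
          Phi (vec_aff (gl_dual p *m v)) (lie (gl_aff (gl_basis p)) y))
  - \sum_p (Phi (gl_aff (gl_dual p)) (aff_corner (gl_basis p) v y) +
            Phi (gl_aff (gl_dual p)) (lie (vec_aff (gl_basis p *m v)) y))
  + 2 *: Phi (vec_aff v) (lie E y) = 0.
Proof.
move=> linl linr alt.
have Dl a b c : Phi (a + b) c = Phi a c + Phi b c.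
  by have := linl c 1 a b; rewrite !scale1r.
have Dr a b c : Phi c (a + b) = Phi c a + Phi c b.
  by have := linr c 1 a b; rewrite !scale1r.
have PhiC a b : Phi a b = - Phi b a.
  by have := alt (a + b); rewrite Dl !Dr !alt add0r addr0 => /eqP; rewrite addr_eq0 => /eqP.
rewrite (aff_split y); move: y.1 y.2 => {y} x w.
pose Psi a b := Phi (gl_aff a) (vec_aff (b *m v)).
have Pl b : linear (Psi^~ b) by move=> a c d; rewrite /Psi linearP linl.
have Pr b : linear (Psi b).
  by move=> a c d; rewrite /Psi mulmxDl -scalemxAl linearP linr.
have E1 : \sum_p Phi (vec_aff (gl_dual p *m v)) (vec_aff (gl_basis p *m w))
    = - Phi (vec_aff v) (vec_aff w).
  under eq_bigr do rewrite PhiC.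
  rewrite sumrN (@casimir_vec _ _ _ (fun a b => Phi (vec_aff a) (vec_aff b))) //.
    by move=> b a c d; rewrite linearP linl.
  by move=> b a c d; rewrite linearP linr.
have E2 : \sum_p Phi (vec_aff (gl_dual p *m v)) (gl_aff (lie (gl_basis p) x))
    = - \sum_p Psi (gl_basis p) (x *m gl_dual p) + \sum_p Psi (gl_basis p) (gl_dual p *m x).
  under eq_bigr do rewrite PhiC lieC linearN /= (linear_opp (linl _)) opprK.
  rewrite (@casimir_ad _ _ _ Psi) //.
  under eq_bigr do rewrite lie_gl (linear_sub (Pr _)).
  by rewrite sumrB opprB addrC.
rewrite !big_split /=.
have -> : \sum_p Phi (vec_aff (gl_dual p *m v)) (aff_tr (gl_basis p) (gl_aff x + vec_aff w)) =
    - Phi (vec_aff v) (vec_aff w).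
  by rewrite -E1; apply: eq_bigr => p _; rewrite /aff_tr /= add0r.
have -> : \sum_p Phi (vec_aff (gl_dual p *m v)) (lie (gl_aff (gl_basis p)) (gl_aff x + vec_aff w))
   = - \sum_p Psi (gl_basis p) (x *m gl_dual p) + \sum_p Psi (gl_basis p) (gl_dual p *m x)
     - Phi (vec_aff v) (vec_aff w).
  rewrite -E1 -E2 -big_split; apply: eq_bigr => p _.
  by rewrite lie_gl_aff Dr /= addr0 add0r.
have -> : \sum_p Phi (gl_aff (gl_dual p)) (aff_corner (gl_basis p) v (gl_aff x + vec_aff w)) =
    \sum_p Psi (gl_basis p) (gl_dual p *m x).
  rewrite (sum_dual (fun a b => Psi a (b *m x))); apply: eq_bigr => p _.
  by rewrite /aff_corner /= addr0 mulmxA.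
have -> : \sum_p Phi (gl_aff (gl_dual p)) (lie (vec_aff (gl_basis p *m v)) (gl_aff x + vec_aff w)) =
    - \sum_p Psi (gl_basis p) (x *m gl_dual p).
  rewrite (sum_dual (fun a b => Psi a (x *m b))) -sumrN; apply: eq_bigr => p _.
  by rewrite lie_vec_aff /= addr0 linearN /= (linear_opp (linr _)) /Psi mulmxA.
rewrite lie_aff_id /= add0r.
set P := \sum_p _; set Q := \sum_p _; lmod K.
Qed.

(** Slot by slot this is [alternating_relation] for the contracted argument and the argument in that
    slot. It absorbs what the commutator of [euler_hom] with [L_v] does to the arguments. *)
Lemma sub_relation v k (f : C k.+1) :
  \sum_p (sub (aff_tr (gl_basis p)) (contr (vec_aff (gl_dual p *m v)) f) +
          sub (lie (gl_aff (gl_basis p))) (contr (vec_aff (gl_dual p *m v)) f))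
  - \sum_p (sub (aff_corner (gl_basis p) v) (contr (gl_aff (gl_dual p)) f) +
            sub (lie (vec_aff (gl_basis p *m v))) (contr (gl_aff (gl_dual p)) f))
  + 2 *: sub (lie E) (contr (vec_aff v) f) = 0.
Proof.
apply/cochainP => w; pose Phi l a b := f (vcons a (upd w l b)).
have subw t e : sub t (contr e f) w = \sum_l Phi l e (t (w l)) by [].
rewrite !(cochainD, cochainN, cochainZ, cochain_sum, cochain0).
under eq_bigr do rewrite cochainD !subw -big_split /=.
under [X in _ - X + _]eq_bigr do rewrite cochainD !subw -big_split /=.
rewrite subw exchange_big [X in _ - X + _]exchange_big /= scaler_sumr.
rewrite -sumrN -!big_split big1 // => l _ /=; apply: alternating_relation.
- by move=> b a c d; apply: (alt_contr_linear _ (cochain_alt f)).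
- move=> c a b d; have := (cochain_alt f).1 (vcons c w) (lift ord0 l) a b d.
  by rewrite !upd_vconsS.
move=> c; apply: ((cochain_alt f).2 _ ord0 (lift ord0 l)) => //.
by rewrite vcons0 vconsS upd_same.
Qed.
End VectorHomotopy.

(** * Lie derivatives of the homotopy along [K^m] *)

Section EulerHomotopy.
Variables (K : fieldType) (m : nat).
Local Notation gl := (gl_lie K m).
Local Notation vec := (vec_lie K m).
Local Notation aff := (Defs_aff_lie__canonical__Defs_LieAlgebra K m).
Local Notation S := (sym_alg aff).
Local Notation C := (cochain aff S).
Local Notation rho := (sym_rep aff).
Local Notation gl_basis := (@gl_basis K m).
Local Notation gl_dual := (@gl_dual K m).
Local Notation vec_basis := (@vec_basis K m).
Local Notation E := (aff_id K m).

Definition aff_rmul (g : gl) (y : aff) : aff := gl_aff (y.1 *m g).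
Fact aff_rmul_is_linear g : linear (aff_rmul g).
Proof.
move=> a y z; congr (_, _) => /=; last by rewrite scaler0 addr0.
by rewrite mulmxDl -scalemxAl.
Qed.
HB.instance Definition _ g :=
  GRing.isLinear.Build K aff aff *:%R (aff_rmul g) (aff_rmul_is_linear g).

Lemma lie_vec_vec (v w : vec) : lie (vec_aff v) (vec_aff w) = 0 :> aff.
Proof. by rewrite lie_vec_aff /= mul0mx oppr0 linear0. Qed.

Lemma lie_vec_gl (v : vec) (x : gl) : lie (vec_aff v) (gl_aff x) = - vec_aff (x *m v) :> aff.
Proof. by rewrite lie_vec_aff /= linearN. Qed.

Lemma post_sym_act (x : aff) k (f : C k) : post (rho x) f = post (der (lie x)) f.
Proof. by apply: post_eq => p; rewrite /= sym_actE. Qed.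

Lemma glopE g k (f : C k) :
  glop g f = post (rho (gl_aff g)) f + 2 *: post (der (aff_rmul g)) f + sub (aff_tr g) f.
Proof.
rewrite /glop post_sym_act.
rewrite (@post_der_comb _ _ _ (aff_rmul g) (lie (gl_aff g)) 2) => [|y]; first by lmod K.
congr (_, _); rewrite /= ?scaler0 ?add0r ?mulmx0 ?subr0 // lie_gl.
by rewrite scaler_nat; lmod K.
Qed.

Lemma lieder_glop_vec v g k (f : C k) :
  lieder rho (vec_aff v) (glop g f) = glop g (lieder rho (vec_aff v) f)
  + post (rho (vec_aff (g *m v))) f + sub (aff_corner g v) f.
Proof.
rewrite /glop linearD /= lieder_post (@lieder_sub _ _ _ _ (aff_corner g v)) => [|y].
  rewrite post_sym_act.
  rewrite [post (der (fun y => _)) f](@post_der_eq _ _ _ (lie (vec_aff (g *m v)))) => [|y].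
    by lmod K.
  rewrite !lie_vec_aff; congr (_, _) => /=.
    by rewrite mul0mx mulmx0 addr0 subrr.
  by rewrite mulmxDl mulmxN !mulmxA; lmod K.
rewrite !lie_vec_aff; congr (_, _); rewrite /= ?subr0 //.
by rewrite mul0mx oppr0 mulmxN opprK add0r.
Qed.

Lemma sum_vec_basis (v : vec) : \sum_a v a 0 *: vec_basis a = v.
Proof. by rewrite [RHS]matrix_sum_delta; apply: eq_bigr => j _; rewrite big_ord1. Qed.

Lemma sum_contr_basis (v : vec) k (f : C k.+1) :
  \sum_a v a 0 *: contr (vec_aff (vec_basis a)) f = contr (vec_aff v) f.
Proof.
rewrite -[in RHS](sum_vec_basis v) linear_sum contr_suml; apply: eq_bigr => a _ /=.
by rewrite linearZ contrZl.
Qed.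

Lemma lieder_mu_vec v k (f : C k.+1) :
  lieder rho (vec_aff v)
    (\sum_a post (der (aff_mu (delta_mx 0 a))) (contr (vec_aff (vec_basis a)) f)) =
  \sum_a post (der (aff_mu (delta_mx 0 a))) (contr (vec_aff (vec_basis a))
    (lieder rho (vec_aff v) f))
  + \sum_p post (der (aff_rmul (gl_basis p))) (contr (vec_aff (gl_dual p *m v)) f)
  - post (rho E) (contr (vec_aff v) f).
Proof.
rewrite (@casimir_gl_vec _ _ _ (fun a b => post (der (aff_rmul a)) (contr (vec_aff b) f))).
- rewrite -(sum_contr_basis v) [X in _ - X]linear_sum -sumrN -!big_split linear_sum.
  apply: eq_bigr => a _ /=; rewrite lieder_post contr_lieder lie_vec_vec contr0l subr0.
  rewrite linearZ /= post_sym_act -addrA; congr (_ + _).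
  (* For a row [r], the commutator of [lie (vec_aff v)] with [aff_mu r] is [aff_rmul (v r)] minus
     the scalar [r v] times [lie E]; here [r v] is [v a 0]. *)
  rewrite [X in X = _](@post_der_comb _ _ _ (lie E) (aff_rmul (v *m delta_mx 0 a)) (- v a 0)).
    by lmod K.
  move=> y; rewrite !lie_vec_aff lie_aff_id; congr (_, _) => /=.
    by rewrite scaler0 !add0r mulNmx opprK mulmxA.
  rewrite subr0 addr0 -mulmxA delta_mulmx big_ord1.
  rewrite (_ : delta_mx 0 0 = 1%:M); last by apply/matrixP => i j; rewrite !ord1 !mxE.
  by rewrite scalemx1 mul_mx_scalar scaleNr.
- move=> b a x y; apply: post_der_comb => z; congr (_, _) => /=; rewrite ?scaler0 ?addr0 //.
  by rewrite mulmxDr -scalemxAr.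
by move=> a b x y; rewrite linearP contr_linearl linearP.
Qed.

(** The expression of [euler_hom_defect] with each [i_a i_b] replaced by [i_a L_b - L_a i_b], its
    commutator with [d] ([contr_contr_dif]). *)
Definition lie_defect u k (f : C k.+1) : C k :=
  \sum_p (contr (aff_tr (gl_basis p) u) (lieder rho (gl_aff (gl_dual p)) f)
          - lieder rho (aff_tr (gl_basis p) u) (contr (gl_aff (gl_dual p)) f))
  + contr (lie E u) (lieder rho E f) - lieder rho (lie E u) (contr E f).

(** The coefficients -2 and -1 make the [aff_rmul] sums coming from [H] and from [glop] cancel,
    [m + 1] matches the multiples of [contr (vec_aff v) f] in [E4], and [sub_relation] takes care of
    the operators on the arguments. *)
Lemma euler_hom_lieder_vec v k (f : C k.+1) :
  lieder rho (vec_aff v) (euler_hom f) =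
  euler_hom (lieder rho (vec_aff v) f) + lie_defect (vec_aff v) f.
Proof.
have E2 : lieder rho (vec_aff v) (\sum_p glop (gl_basis p) (contr (gl_aff (gl_dual p)) f)) =
    \sum_p glop (gl_basis p) (contr (gl_aff (gl_dual p)) (lieder rho (vec_aff v) f))
    - \sum_p glop (gl_basis p) (contr (vec_aff (gl_dual p *m v)) f)
    + \sum_p post (rho (vec_aff (gl_basis p *m v))) (contr (gl_aff (gl_dual p)) f)
    + \sum_p sub (aff_corner (gl_basis p) v) (contr (gl_aff (gl_dual p)) f).
  rewrite linear_sum -sumrN -!big_split; apply: eq_bigr => p _ /=.
  rewrite lieder_glop_vec contr_lieder lie_vec_gl contrNl linearB /= linearN.
  by lmod K.
have E3 : \sum_p glop (gl_basis p) (contr (vec_aff (gl_dual p *m v)) f) =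
    \sum_p post (rho (gl_aff (gl_basis p))) (contr (vec_aff (gl_dual p *m v)) f)
    + 2 *: (\sum_p post (der (aff_rmul (gl_basis p))) (contr (vec_aff (gl_dual p *m v)) f))
    + \sum_p sub (aff_tr (gl_basis p)) (contr (vec_aff (gl_dual p *m v)) f).
  by rewrite scaler_sumr -!big_split; apply: eq_bigr => p _; rewrite glopE.
have E4 : lie_defect (vec_aff v) f =
    \sum_p post (rho (gl_aff (gl_basis p))) (contr (vec_aff (gl_dual p *m v)) f)
    - \sum_p sub (lie (gl_aff (gl_basis p))) (contr (vec_aff (gl_dual p *m v)) f)
    - m%:R *: contr (vec_aff v) f
    - \sum_p post (rho (vec_aff (gl_basis p *m v))) (contr (gl_aff (gl_dual p)) f)
    + \sum_p sub (lie (vec_aff (gl_basis p *m v))) (contr (gl_aff (gl_dual p)) f)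
    + lieder rho E (contr (vec_aff v) f) - contr (vec_aff v) f
    - lieder rho (vec_aff v) (contr E f).
  have tr p : aff_tr (gl_basis p) (vec_aff v) = vec_aff (gl_basis p *m v) by [].
  rewrite /lie_defect lie_aff_id /= contr_lieder lie_aff_id /=.
  rewrite big_split /= sumrN.
  have -> : \sum_p contr (aff_tr (gl_basis p) (vec_aff v)) (lieder rho (gl_aff (gl_dual p)) f) =
      \sum_p lieder rho (gl_aff (gl_basis p)) (contr (vec_aff (gl_dual p *m v)) f)
      - m%:R *: contr (vec_aff v) f.
    rewrite (sum_dual (fun a b => lieder rho (gl_aff a) (contr (vec_aff (b *m v)) f))).
    (* The brackets contract with the sum of the [E_ji E_ij v], which is [m v]. *)
    rewrite -contrZl -linearZ /= -mul_scalar_mx -sum_mul_dual mulmx_suml linear_sum.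
    rewrite contr_suml -sumrB; apply: eq_bigr => p _.
    by rewrite tr contr_lieder gl_vec_aff_lie mulmxA.
  have lied (F : 'I_m * 'I_m -> aff) (G : 'I_m * 'I_m -> C k) :
      \sum_p lieder rho (F p) (G p) =
      \sum_p post (rho (F p)) (G p) - \sum_p sub (lie (F p)) (G p).
    by rewrite -sumrB; apply: eq_bigr => p _; rewrite liederE.
  rewrite !lied /=; lmod K.
rewrite E4 !euler_homE !linearD /= linearN !linearZ /= lieder_mu_vec E2 E3.
rewrite lieder_lieder !contr_lieder [lie _ E]lie_vec_gl mul1mx contrNl liederNl.
rewrite !linearB /= linearN /=.
have := sub_relation v f; rewrite !big_split /= => R.
rewrite -[RHS]addr0 -[X in _ = _ + X]R [lieder rho E (contr (vec_aff v) f)]liederE.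
set A1 := \sum_(a < m) _; set A2 := \sum_p post (der (aff_rmul _)) _.
lmod K.
Qed.
End EulerHomotopy.

(** * The homotopy formula *)

Section EulerTheorem.
Variables (K : fieldType) (m : nat).
Local Notation gl := (gl_lie K m).
Local Notation vec := (vec_lie K m).
Local Notation aff := (Defs_aff_lie__canonical__Defs_LieAlgebra K m).
Local Notation S := (sym_alg aff).
Local Notation C := (cochain aff S).
Local Notation rho := (sym_rep aff).
Local Notation E := (aff_id K m).
Local Notation d := (dif rho).

(** [aff_tr] and [lie E] vanish on [gl_m], so [lie_defect] depends only on the [K^m] component of
    [u]. *)
Lemma euler_hom_lieder u k (f : C k.+1) :
  lieder rho u (euler_hom f) = euler_hom (lieder rho u f) + lie_defect u f.
Proof.
rewrite (aff_split u) liederDl euler_hom_lieder_gl euler_hom_lieder_vec.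
have -> : lie_defect (gl_aff u.1 + vec_aff u.2) f = lie_defect (vec_aff u.2) f.
  rewrite /lie_defect !lie_aff_id /= add0r.
  congr (_ + _ - _); apply: eq_bigr => p _.
  by rewrite /aff_tr /= add0r.
by rewrite liederDl linearD addrA.
Qed.

Lemma euler_hom_defect_difS u k (f : C k.+2) :
  euler_hom_defect u (d f) = lie_defect u f + d (euler_hom_defect u f).
Proof.
rewrite /euler_hom_defect linearD /= linear_sum /= /lie_defect.
under eq_bigr do rewrite contr_contr_dif.
rewrite contr_contr_dif big_split /=.
by set A := \sum_p _; set B := \sum_p _; lmod K.
Qed.

Lemma euler_hom_defect_dif1 u (f : C 1) : euler_hom_defect u (d f) = lie_defect u f.
Proof.
rewrite /euler_hom_defect /lie_defect; under eq_bigr do rewrite contr_contr_dif1.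
by rewrite contr_contr_dif1 addrA.
Qed.

Lemma euler_homotopy0 (f : C 0) : euler_hom (d f) = 2 *: post (der idfun) f.
Proof.
have L u : contr u (d f) = post (rho u) f.
  by rewrite contr_dif0 liederE sub0c subr0.
rewrite euler_homE; apply/cochainP => v.
rewrite [RHS]cochainZ [post _ f v]postE -(euler_second_order (f v)).
rewrite !cochainD cochainN !cochainZ !cochain_sum !L.
rewrite liederE sub0c subr0 !postE; congr (_ *: _ - _ + _ + _).
  by apply: eq_bigr => a _; rewrite L !postE.
by apply: eq_bigr => p _; rewrite /glop L sub0c addr0 !postE.
Qed.

(** After contraction with [u] the two defects cancel, and the formula for [contr u f] remains. *)
Theorem euler_homotopy k (f : C k.+1) :
  d (euler_hom f) + euler_hom (d f) = 2 *: post (der idfun) f.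
Proof.
elim: k f => [|k IH] f; apply: contr_ext => u; rewrite linearD /= contr_euler_hom.
  rewrite contr_dif0 contr_difS linearB /= euler_homotopy0.
  rewrite euler_hom_lieder euler_hom_defect_dif1 [RHS]linearZ /= contr_post.
  by lmod K.
rewrite !contr_difS linearB /= contr_euler_hom euler_hom_lieder euler_hom_defect_difS.
rewrite [RHS]linearZ /= contr_post -IH linearB linearN /=; lmod K.
Qed.
End EulerTheorem.

Section PostDif.
Variables (K : fieldType) (L : lieAlgType K) (M1 M2 : lmodType K).
Variables (rho1 : lieRep L M1) (rho2 : lieRep L M2) (P : {linear M1 -> M2}).

Lemma post_dif k (f : cochain L M1 k) : (forall x m, P (rho1 x m) = rho2 x (P m)) ->
  post P (dif rho1 f) = dif rho2 (post P f).
Proof.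
move=> PE; have pull_id j (g : cochain L M2 j) : pull idfun g = g by apply/cochainP.
by have := @pull_dif _ _ _ _ _ rho1 rho2 idfun P _ PE k f; rewrite !pull_id; apply.
Qed.
End PostDif.

(** * Cohomology *)

Section Coboundary.
Variables (K : fieldType) (L : lieAlgType K) (M : lmodType K) (rho : lieRep L M).

Definition coboundary k : cochain L M k -> Prop :=
  match k with 0 => fun f => f = 0 | k'.+1 => fun f => exists g, f = dif rho g end.

Lemma coboundaryP k (f : cochain L M k) : coboundary f <-> is_coboundary rho f.
Proof.
case: k f => [|k] f /=; first by split=> [->|f0] //; apply/val_inj.
split=> [[g ->]|[g gA E]]; first by exists g; first exact: cochain_alt.
by exists (mk_cochain gA); apply/val_inj.
Qed.

Definition cocycle_of k (f : cochain L M k) (df : dif rho f = 0) : cocycle rho k :=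
  Cocycle (introT (asboolP _) ((cocycleP rho f).2 df)).

Lemma cocycle_alt k (z : cocycle rho k) : alt_multilinear z.
Proof. by have /asboolP[] := cocycle_valP z. Qed.
Definition cochain_of k (z : cocycle rho k) : cochain L M k := mk_cochain (cocycle_alt z).

Lemma dif_cochain_of k (z : cocycle rho k) : dif rho (cochain_of z) = 0.
Proof. by apply/cocycleP; have /asboolP := cocycle_valP z. Qed.

Lemma cochain_of_linear k : linear (@cochain_of k).
Proof. by move=> a x y; apply/val_inj. Qed.
HB.instance Definition _ k := GRing.isLinear.Build K (cocycle rho k) (cochain L M k)
  *:%R (@cochain_of k) (@cochain_of_linear k).

Lemma mem_coboundary k (z : cocycle rho k) :
  (z \in coboundary_pred rho k) <-> coboundary (cochain_of z).
Proof. by rewrite coboundaryP; split=> /asboolP. Qed.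

Definition coh_class k (z : cocycle rho k) : coh rho k :=
  \pi_(lmod_quot (coboundary_pred rho k))%qT z.

Fact coh_class_is_linear k : linear (@coh_class k).
Proof. exact: (pi_lmod_linear (coboundary_pred rho k)). Qed.
HB.instance Definition _ k := GRing.isLinear.Build K (cocycle rho k) (coh rho k) *:%R
  (@coh_class k) (@coh_class_is_linear k).

Lemma coh_class_eq k (y z : cocycle rho k) :
  coboundary (cochain_of y - cochain_of z) <-> coh_class y = coh_class z.
Proof.
rewrite -linearB /= -mem_coboundary -pi_lmod_eq.
by split=> [/eqP|E] //; apply/eqP.
Qed.

Lemma coh_classP k (h : coh rho k) : exists z, h = coh_class z.
Proof. by exists (repr h); rewrite /coh_class reprK. Qed.
End Coboundary.

Section CohMap.
Variables (K : fieldType) (L1 L2 : lieAlgType K) (M1 M2 : lmodType K).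
Variables (rho1 : lieRep L1 M1) (rho2 : lieRep L2 M2) (k : nat).
Variable Psi : {linear cochain L1 M1 k -> cochain L2 M2 k}.
Hypothesis Psi_cocycle : forall f, dif rho1 f = 0 -> dif rho2 (Psi f) = 0.
Hypothesis Psi_coboundary : forall f, coboundary rho1 f -> coboundary rho2 (Psi f).

Definition cocycle_map (z : cocycle rho1 k) : cocycle rho2 k :=
  cocycle_of (Psi_cocycle (dif_cochain_of z)).
Definition coh_map (h : coh rho1 k) : coh rho2 k := coh_class (cocycle_map (repr h)).

Lemma cochain_of_map z : cochain_of (cocycle_map z) = Psi (cochain_of z).
Proof. exact/val_inj. Qed.

Lemma coh_map_class z : coh_map (coh_class z) = coh_class (cocycle_map z).
Proof.
apply/coh_class_eq; rewrite !cochain_of_map -linearB; apply: Psi_coboundary.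
by apply/coh_class_eq; rewrite /coh_class reprK.
Qed.

Lemma coh_map_linear : linear coh_map.
Proof.
move=> a g h; have [y ->] := coh_classP g; have [z ->] := coh_classP h.
rewrite -linearP !coh_map_class -linearP.
by congr coh_class; apply/val_inj; rewrite /= linearP linearP.
Qed.
End CohMap.

Lemma coh_iso (K : fieldType) (L1 L2 : lieAlgType K) (M1 M2 : lmodType K)
    (rho1 : lieRep L1 M1) (rho2 : lieRep L2 M2) k
    (Psi : {linear cochain L1 M1 k -> cochain L2 M2 k})
    (Phi : {linear cochain L2 M2 k -> cochain L1 M1 k}) :
  (forall f, dif rho1 f = 0 -> dif rho2 (Psi f) = 0) ->
  (forall f, coboundary rho1 f -> coboundary rho2 (Psi f)) ->
  (forall f, dif rho2 f = 0 -> dif rho1 (Phi f) = 0) ->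
  (forall f, coboundary rho2 f -> coboundary rho1 (Phi f)) ->
  (forall f, Psi (Phi f) = f) ->
  (forall f, dif rho1 f = 0 -> coboundary rho1 (Phi (Psi f) - f)) ->
  lmod_iso (coh rho1 k) (coh rho2 k).
Proof.
move=> Psiz Psib Phiz Phib PsiK PhiK.
pose F : {linear coh rho1 k -> coh rho2 k} :=
  HB.pack (coh_map Psiz) (GRing.isLinear.Build K _ _ _ _ (coh_map_linear Psiz Psib)).
exists F; exists (coh_map Phiz) => h; have [z ->] := coh_classP h; rewrite /F /=.
  rewrite !coh_map_class //; apply/coh_class_eq; rewrite !cochain_of_map.
  exact/PhiK/dif_cochain_of.
rewrite !coh_map_class //; apply/coh_class_eq; rewrite !cochain_of_map PsiK subrr.
exact/coboundaryP/is_coboundary0.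
Qed.

(** * Scalar cohomology of [g] and the weights of the identity matrix *)

Section ScalarCohomology.
Variables (K : fieldType) (m : nat).
Hypothesis charK : [pchar K] =i pred0.
Local Notation gl := (Defs_gl_lie__canonical__Defs_LieAlgebra K m).
Local Notation vec := (vec_lie K m).
Local Notation aff := (Defs_aff_lie__canonical__Defs_LieAlgebra K m).
Local Notation C := (cochain aff K^o).
Local Notation triv := (lieRep_trivial aff K^o).
Local Notation E := (aff_id K m).
Local Notation T := (sub (lie E)).

Definition aff_fst (y : aff) : gl := y.1.
Fact aff_fst_is_linear : linear aff_fst.
Proof. by []. Qed.
HB.instance Definition _ := GRing.isLinear.Build K aff gl *:%R aff_fst aff_fst_is_linear.

Definition aff_retract (y : aff) : aff := gl_aff y.1.
Fact aff_retract_is_linear : linear aff_retract.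
Proof. by move=> a y z; congr (_, _); rewrite /= scaler0 addr0. Qed.
HB.instance Definition _ :=
  GRing.isLinear.Build K aff aff *:%R aff_retract aff_retract_is_linear.

Lemma lieder_triv (L : lieAlgType K) (M : lmodType K) u k (f : cochain L M k) :
  lieder (lieRep_trivial L M) u f = - sub (lie u) f.
Proof. by rewrite liederE post_null ?sub0r. Qed.

(* The operator [T] has eigenvalues [0, ..., k] on [k]-cochains, so that the product
   of the [1 - T / j] over [1 <= j <= s] is the projector onto its kernel for [s >= k]. *)
Fixpoint weight_proj s k (c : C k) : C k := match s with
  | 0 => c
  | s'.+1 => weight_proj s' c - (s'.+1)%:R^-1 *: T (weight_proj s' c) end.

Lemma weight_proj_coboundary s k (c : C k) : dif triv c = 0 ->
  dif triv (weight_proj s c) = 0 /\ coboundary triv (c - weight_proj s c).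
Proof.
move=> dc; elim: s => [|s [ds cs]] /=.
  by split; rewrite ?subrr //; apply/coboundaryP/is_coboundary0.
set c' := weight_proj s c in ds cs *.
have TE j (g : C j) : T g = - lieder triv E g by rewrite lieder_triv opprK.
have cT j (g : C j) : dif triv g = 0 -> coboundary triv (T g).
  case: j g => [|j] g dg; first by rewrite /= sub0c.
  exists (- contr E g); rewrite TE linearN /=; congr (- _).
  by apply/eqP; rewrite -subr_eq0 -contr_difS dg linear0.
have dT : dif triv (T c') = 0 by rewrite TE linearN /= -lieder_dif ds linear0 oppr0.
split; first by rewrite linearB linearZ /= ds dT scaler0 subr0.
rewrite opprB addrA addrAC addrC; apply/coboundaryP.
by apply: (@is_coboundaryP _ _ _ triv k _ (T c') (c - c')); apply/coboundaryP => //; apply: cT.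
Qed.

Lemma contr_T u k (f : C k.+1) : contr u (T f) = T (contr u f) + contr (vec_aff u.2) f.
Proof. by rewrite contr_sub; congr (_ + contr _ _); apply: lie_aff_id. Qed.

Lemma contr_weight_proj_gl s x k (c : C k.+1) :
  contr (gl_aff x) (weight_proj s c) = weight_proj s (contr (gl_aff x) c).
Proof.
elim: s => //= s IH; rewrite linearB linearZ /= contr_T.
by rewrite linear0 contr0l addr0 IH.
Qed.

(** As [i_v T = (T + 1) i_v], the factors [1 - T / j] become [(j - 1 - T) / j]. The first one is
    [- T], and the others telescope to [1 / (s + 1)] times the product for [s]. *)
Lemma contr_weight_proj_vec s v k (c : C k.+1) :
  contr (vec_aff v) (weight_proj s.+1 c) =
  - (s.+1)%:R^-1 *: T (weight_proj s (contr (vec_aff v) c)).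
Proof.
have vE j (f : C j.+1) : contr (vec_aff v) (T f) = T (contr (vec_aff v) f) + contr (vec_aff v) f.
  exact: contr_T.
have nz j : (j.+1)%:R != 0 :> K by rewrite (pcharf0P K).1.
elim: s => [|s IH]; first by rewrite /= linearB linearZ /= vE invr1; lmod K.
have wS j i (f : C i) : weight_proj j.+1 f =
  weight_proj j f - (j.+1)%:R^-1 *: T (weight_proj j f) by [].
rewrite (wS s.+1) linearB; set Y := weight_proj s.+1 c in IH *.
rewrite linearZ /= vE IH !linearB !linearZ /=; set X := T (weight_proj s _).
have -> : - (s.+2)%:R^-1 *: X = - (s.+1)%:R^-1 *: X + ((s.+1)%:R^-1 * (s.+2)%:R^-1) *: X.
  rewrite -scalerDl; congr (_ *: _); have := nz s; have := nz s.+1.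
  rewrite -[(s.+2)%:R]natr1; move: (s.+1)%:R => x n2 n1.
  by field; rewrite n1 n2.
by lmod K.
Qed.

Lemma weight_projE s k (c : C k) : (k <= s)%N -> weight_proj s c = pull aff_retract c.
Proof.
elim: k s c => [|k IH] s c ks.
  have -> : weight_proj s c = c by elim: s {ks} => //= s ->; rewrite sub0c scaler0 subr0.
  by apply/cochainP => v; rewrite pullE; congr (c _); apply: ord0_fun.
case: s ks => // s ks; apply: contr_ext => u; rewrite [u in LHS]aff_split contrDl contr_pull.
rewrite contr_weight_proj_gl contr_weight_proj_vec !IH ?(ltnW ks) //.
(* [aff_retract] kills the image of [lie E], so [T] vanishes on the pulled back cochain. *)
rewrite -(@pull_sub _ _ _ _ aff_retract \0) ?sub_null ?linear0 ?scaler0 ?addr0 //.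
by move=> y; rewrite -[LHS]/(aff_retract (lie E y)) lie_aff_id.
Qed.

Lemma retract_cohomologous k (c : C k) : dif triv c = 0 ->
  coboundary triv (c - pull aff_retract c).
Proof.
move=> dc; rewrite -(weight_projE c (leqnn k)).
exact: (weight_proj_coboundary k dc).2.
Qed.
End ScalarCohomology.

(** * Cohomology of [g] with symmetric coefficients *)

Section AffineCohomology.
Variables (K : fieldType) (m : nat).
Hypothesis charK : [pchar K] =i pred0.
Local Notation gl := (Defs_gl_lie__canonical__Defs_LieAlgebra K m).
Local Notation aff := (Defs_aff_lie__canonical__Defs_LieAlgebra K m).
Local Notation S := (sym_alg aff).
Local Notation rho := (sym_rep aff).
Local Notation triv := (lieRep_trivial aff K^o).
Local Notation gl_triv := (lieRep_trivial gl K^o).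

Definition scal (V : vectType K) (c : K^o) : sym_alg V := c%:A.
Fact scal_is_linear V : linear (@scal V).
Proof. by move=> a b c; rewrite /scal scalerDl scalerA. Qed.
HB.instance Definition _ V := GRing.isLinear.Build K K^o (sym_alg V) *:%R
  (@scal V) (@scal_is_linear V).

Lemma two_neq0 : 2 != 0 :> K.
Proof. by rewrite (pcharf0P K).1. Qed.

Lemma post_euler_inv (L : lieAlgType K) k (f : cochain L S k) :
  post (@euler_inv K aff) (post (der idfun) f) = f - post (@scal aff) (post (@aug K aff) f).
Proof. by apply/cochainP => v; rewrite cochainD cochainN !postE /= eulerK. Qed.

Lemma euler_inv_rep (u : aff) (p : S) : euler_inv (rho u p) = rho u (euler_inv p).
Proof. by rewrite /= !sym_actE (@euler_inv_der _ _ charK (lie u)). Qed.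

Lemma aug_rep (u : aff) (p : S) : aug (rho u p) = 0.
Proof. by rewrite /= sym_actE aug_der. Qed.

(** Off the constants the Euler operator has an inverse that commutes with [g]; applied to half the
    homotopy, it yields a primitive. *)
Lemma sym_rep_euler k (F : cochain aff S k) : dif rho F = 0 ->
  coboundary rho (F - post (@scal aff) (post (@aug K aff) F)).
Proof.
rewrite -post_euler_inv; case: k F => [|k] F dF.
  have := euler_homotopy0 F; rewrite dF linear0 => /esym/eqP.
  by rewrite scaler_eq0 (negbTE two_neq0) => /eqP-> /=; rewrite linear0.
have := euler_homotopy F; rewrite dF linear0 addr0 => dh.
exists (post (@euler_inv K aff) (2^-1 *: euler_hom F)).
rewrite -(post_dif _ euler_inv_rep) linearZ /= dh scalerA mulVf ?scale1r //.
exact: two_neq0.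
Qed.

Lemma coboundary_scal k (c : cochain aff K^o k) :
  coboundary triv c -> coboundary rho (post (@scal aff) c).
Proof.
case: k c => [|k] c /=; first by move=> ->; rewrite linear0.
case=> g ->; exists (post (@scal aff) g); apply: post_dif => u p.
by rewrite /= /scal sym_actA scale0r.
Qed.

Definition aff_to_gl k : cochain aff S k -> cochain gl K^o k :=
  @pull _ _ _ _ (@gl_aff K m) k \o @post _ _ _ _ (@aug K aff) k.
Definition gl_to_aff k : cochain gl K^o k -> cochain aff S k :=
  @pull _ _ _ _ (@aff_fst K m) k \o @post _ _ _ _ (@scal aff) k.
HB.instance Definition _ k := GRing.Linear.on (@aff_to_gl k).
HB.instance Definition _ k := GRing.Linear.on (@gl_to_aff k).

Lemma aff_to_gl_dif k (F : cochain aff S k) :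
  aff_to_gl (dif rho F) = dif gl_triv (aff_to_gl F).
Proof.
apply: (@pull_dif _ _ _ _ _ rho gl_triv) => [x y|u p]; last exact: aug_rep.
by congr (_, _); rewrite /= mulmx0 mulmx0 subr0.
Qed.

Lemma gl_to_aff_dif k (c : cochain gl K^o k) :
  gl_to_aff (dif gl_triv c) = dif rho (gl_to_aff c).
Proof.
apply: (@pull_dif _ _ _ _ _ gl_triv rho) => [x y|u p] //.
by rewrite /= /scal sym_actA scale0r.
Qed.

Lemma coh_sym_aff k : lmod_iso (coh rho k) (coh gl_triv k).
Proof.
apply: (@coh_iso _ _ _ _ _ rho gl_triv k (@aff_to_gl k) (@gl_to_aff k)).
- by move=> f df; rewrite -aff_to_gl_dif df linear0.
- case: k => [|k] f /=; first by move=> ->; rewrite linear0.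
  by case=> g ->; exists (aff_to_gl g); rewrite -aff_to_gl_dif.
- by move=> f df; rewrite -gl_to_aff_dif df linear0.
- case: k => [|k] f /=; first by move=> ->; rewrite linear0.
  by case=> g ->; exists (gl_to_aff g); rewrite -gl_to_aff_dif.
- by move=> c; apply/cochainP => v; apply: (@augA K aff (c v)).
move=> F dF; set c := post (@aug K aff) F.
(* The comparison has two stages: first the coefficients of positive degree are dropped, then the
   arguments in [K^m]. *)
have -> : gl_to_aff (aff_to_gl F) - F =
    (-1) *: (F - post (@scal aff) c) + (-1) *: post (@scal aff) (c - pull (@aff_retract K m) c).
  have -> : gl_to_aff (aff_to_gl F) = post (@scal aff) (pull (@aff_retract K m) c).
    by apply/cochainP.
  by rewrite [post _ (c - _)]linearB; lmod K.
apply/coboundaryP/(@is_coboundaryP _ _ _ rho k); first exact/coboundaryP/sym_rep_euler.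
have dc : dif triv c = 0.
  by rewrite -(@post_dif _ _ _ _ rho) ?dF ?linear0 // => u p; exact: aug_rep.
have cc := coboundary_scal (retract_cohomologous charK dc).
have := @is_coboundaryP _ _ _ rho k (-1) (post (@scal aff) (c - pull (@aff_retract K m) c)) 0.
by rewrite addr0; apply; [exact/coboundaryP|exact: is_coboundary0].
Qed.
End AffineCohomology.

(** * Vanishing of the second scalar cohomology of [gl_m] *)

Section SecondCohomology.
Variables (K : fieldType) (m : nat).
Hypotheses (charK : [pchar K] =i pred0) (m_gt0 : (0 < m)%N).
Local Notation gl := (Defs_gl_lie__canonical__Defs_LieAlgebra K m).
Local Notation triv := (lieRep_trivial gl K^o).
Local Notation gl_basis := (@gl_basis K m).
Local Notation gl_dual := (@gl_dual K m).

Section Cocycle.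
Variable c : cochain gl K^o 2.
Hypothesis dc : dif triv c = 0.

Let beta (x y : gl) : K^o := contr y (contr x c) (fun _ => 0).

Let beta_linl y : linear (beta^~ y).
Proof. by move=> a x z; rewrite /beta contr_linearl linearP. Qed.

Let beta_linr x : linear (beta x).
Proof. by move=> a y z; rewrite /beta contr_linearl. Qed.

Let betaxx x : beta x x = 0.
Proof. by rewrite /beta contr_anti. Qed.

Let betaC x y : beta x y = - beta y x.
Proof. by rewrite /beta contrC. Qed.

Let beta_cocycle x y z : beta x (lie y z) = beta y (lie x z) + beta (lie x y) z.
Proof.
have : contr z (contr y (contr x (dif triv c))) = 0 by rewrite dc !linear0.
rewrite contr_contr_dif linearD linearB /= contr_dif0 !lieder_triv !linearN /=.
rewrite !contr_sub !linearD /= !contr_sub !sub0c !add0r.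
move=> /(congr1 (fun g : cochain gl K^o 0 => g (fun _ => 0))).
rewrite !(cochainD, cochainN, cochain0) -!/(beta _ _).
by move=> H; apply/eqP; rewrite -subr_eq0; apply/eqP; rewrite -[RHS]H; lmod K.
Qed.

Let id_gl : gl := 1%:M.
Let lie_id x : lie id_gl x = 0.
Proof. by rewrite /id_gl lie_gl mul1mx mulmx1 subrr. Qed.

Let m_neq0 : m%:R != 0 :> K.
Proof. by rewrite (pcharf0P K).1 // -lt0n. Qed.

(** The centre is treated apart, since the adjoint Casimir operator kills it. [beta id_gl] vanishes
    on brackets, and [m x - tr(x) 1] is a sum of brackets. *)
Let beta_id x : beta id_gl x = 0.
Proof.
have lie0 y z : beta id_gl (lie y z) = 0.
  by rewrite beta_cocycle !lie_id /beta !contr0l linear0 addr0.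
have E : \sum_p lie (gl_basis p) (gl_dual p *m x) = m%:R *: x - \tr x *: id_gl :> gl.
  under eq_bigr do rewrite lie_gl mulmxA.
  rewrite sumrB -mulmx_suml casimir_mul mul_scalar_mx.
  by rewrite sum_dual_mul -scalemx1.
have : beta id_gl (m%:R *: x - \tr x *: id_gl) = 0.
  rewrite -E -[X in beta X]/id_gl.
  pose B : {linear gl -> K^o} := HB.pack (beta id_gl)
    (GRing.isLinear.Build K gl K^o _ _ (beta_linr id_gl)).
  by rewrite -[beta id_gl _]/(B _) linear_sum big1 // => p _; apply: lie0.
rewrite (linear_sub (beta_linr _)) !(linear_scale (beta_linr _)) betaxx scaler0 subr0.
by move=> /eqP; rewrite scaler_eq0 (negbTE m_neq0) => /eqP.
Qed.

Let casimir_adjoint x :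
  \sum_p lie (gl_basis p) (lie (gl_dual p) x) = (2 * m%:R) *: x - (2 * \tr x) *: id_gl :> gl.
Proof.
under eq_bigr do rewrite !lie_gl mulmxBr mulmxBl !mulmxA.
rewrite !sumrB casimir_trace sum_dual_mul -!mulmx_suml casimir_mul.
under [X in _ - (_ - X)]eq_bigr do rewrite -mulmxA.
rewrite -mulmx_sumr sum_mul_dual mul_scalar_mx mul_mx_scalar -[(\tr x)%:M]scalemx1.
by lmod K.
Qed.

(** The Casimir homotopy: contract [beta] with [E_ij], then let [E_ji] act on the remaining
    argument. *)
Let gamma y : K^o := \sum_p beta (gl_basis p) (lie (gl_dual p) y).

Let gamma_lie y z : gamma (lie y z) = (2 * m%:R) *: beta y z.
Proof.
have beta_sum x (F : 'I_m * 'I_m -> gl) : \sum_p beta x (F p) = beta x (\sum_p F p).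
  pose B : {linear gl -> K^o} := HB.pack (beta x)
    (GRing.isLinear.Build K gl K^o _ _ (beta_linr x)).
  by rewrite -[beta x (\sum_p _)]/(B _) linear_sum.
have beta_cas x : beta x (\sum_p lie (gl_basis p) (lie (gl_dual p) z)) = (2 * m%:R) *: beta x z.
  rewrite casimir_adjoint (linear_sub (beta_linr _)) !(linear_scale (beta_linr _)).
  by rewrite [beta x id_gl]betaC beta_id oppr0 scaler0 subr0.
have jac (a b e : gl) : lie a (lie b e) = lie (lie a b) e + lie b (lie a e).
  by rewrite lie_lie subrK.
pose X1 := \sum_p beta (lie (gl_dual p) y) (lie (gl_basis p) z).
pose X2 := \sum_p beta (lie (gl_basis p) y) (lie (gl_dual p) z).
pose Y := \sum_p beta (lie (gl_basis p) (lie (gl_dual p) y)) z.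
have XY : \sum_p beta (gl_basis p) (lie (lie (gl_dual p) y) z) = X1 + Y.
  by rewrite -big_split; apply: eq_bigr => p _; apply: beta_cocycle.
(* By invariance of the tensor, [X2] cancels the part [X1 + Y] of [gamma (lie y z)]; only the
   adjoint Casimir operator inside [beta y] survives. *)
have X2E : X2 = - (X1 + Y).
  rewrite /X2; under eq_bigr do rewrite lieC (linear_opp (beta_linl _)).
  rewrite sumrN (@casimir_ad _ _ _ (fun a b => beta a (lie b z))); first last.
  - by move=> a b u w; rewrite lieDl lieZl (beta_linr _).
  - by move=> b; apply: beta_linl.
  rewrite opprK -XY -sumrN; apply: eq_bigr => p _.
  rewrite -(linear_opp (beta_linr _)); congr (beta _ _).
  by rewrite [lie y _]lieC -[- lie (gl_dual p) y]scaleN1r lieZl scaleN1r.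
rewrite /gamma; under eq_bigr do rewrite jac.
transitivity (X1 + Y + (beta y (\sum_p lie (gl_basis p) (lie (gl_dual p) z)) + X2)).
  rewrite -XY -beta_sum -!big_split; apply: eq_bigr => p _ /=.
  have -> a b : beta (gl_basis p) (a + b) = beta (gl_basis p) a + beta (gl_basis p) b.
    by have := beta_linr (gl_basis p) 1 a b; rewrite !scale1r.
  by rewrite [beta _ (lie y _)]beta_cocycle.
by rewrite X2E beta_cas; lmod K.
Qed.

Lemma gl_coboundary2 : exists g, c = dif triv g.
Proof.
pose g : cochain gl K^o 1 := \sum_p sub (lie (gl_dual p)) (contr (gl_basis p) c).
have gE y : contr y g (fun _ => 0) = gamma y.
  have -> : contr y g = \sum_p contr (lie (gl_dual p) y) (contr (gl_basis p) c).
    by rewrite linear_sum; apply: eq_bigr => p _ /=; rewrite contr_sub sub0c add0r.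
  exact: cochain_sum.
(* The constant [2 m] is that of [gamma_lie]; the sign comes from [d g (x, y) = - g [x, y]]. *)
exists (- (2 * m%:R)^-1 *: g); apply: contr_ext => x; apply: contr_ext => y.
rewrite linearZ /= !linearZ /= contr_contr_dif1 !lieder_triv sub0c oppr0 subr0.
rewrite linearN /= contr_sub sub0c add0r; apply/cochainP => v.
rewrite (ord0_fun v (fun=> 0)) cochainZ cochainN gE gamma_lie -/(beta x y).
have nz : 2 * m%:R != 0 :> K by rewrite mulf_neq0 // (pcharf0P K).1.
by rewrite scaleNr scalerN opprK scalerA mulVf // scale1r.
Qed.
End Cocycle.

Lemma coh_gl2 : lmod_trivial (coh triv 2).
Proof.
move=> h; have [z ->] := coh_classP h.
have [g zE] := gl_coboundary2 (dif_cochain_of z).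
rewrite -[RHS](linear0 (@coh_class _ _ _ triv 2)).
by apply/coh_class_eq; rewrite linear0 subr0; exists g.
Qed.
End SecondCohomology.

(** * Invariant classes in the cohomology of [K^m] *)

Section VectorCohomology.
Variables (K : fieldType) (m : nat).
Hypothesis charK : [pchar K] =i pred0.
Local Notation gl := (gl_lie K m).
Local Notation vec := (Defs_vec_lie__canonical__Defs_LieAlgebra K m).
Local Notation aff := (Defs_aff_lie__canonical__Defs_LieAlgebra K m).
Local Notation S := (sym_alg aff).
Local Notation rho := (sym_rep aff).
Local Notation nrep := (vec_sym_rep K m).
Local Notation gl_basis := (@gl_basis K m).
Local Notation gl_dual := (@gl_dual K m).
Local Notation E := (aff_id K m).

Definition aff_snd (y : aff) : vec := y.2.
Fact aff_snd_is_linear : linear aff_snd.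
Proof. by []. Qed.
HB.instance Definition _ := GRing.isLinear.Build K aff vec *:%R aff_snd aff_snd_is_linear.

Definition gl_act x k (f : cochain vec S k) : cochain vec S k :=
  locked (post (rho (gl_aff x)) f - sub (mulv x) f).

Lemma gl_actE x k (f : cochain vec S k) :
  gl_act x f = post (rho (gl_aff x)) f - sub (mulv x) f.
Proof. by rewrite /gl_act -lock. Qed.

Lemma gl_act_cochain x k (f : cochain vec S k) :
  gl_act x f = cochain_act (gl_eqv x) f :> (_ -> _).
Proof. by rewrite gl_actE. Qed.

Lemma gl_act_dif x k (f : cochain vec S k) :
  gl_act x (dif nrep f) = dif nrep (gl_act x f).
Proof.
apply/val_inj; rewrite /= gl_act_cochain difE gl_act_cochain.
exact: (cochain_act_diff (gl_eqv x) (cochain_alt f)).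
Qed.

Definition vec_glop x k (f : cochain vec S k) : cochain vec S k :=
  post (der (aff_sym x)) f + sub (mulv x) f.

Definition aff_lmul (x : gl) (y : aff) : aff := (x *m y.1, x *m y.2).
Fact aff_lmul_is_linear x : linear (aff_lmul x).
Proof. by move=> a y z; congr (_, _) => /=; rewrite mulmxDr -scalemxAr. Qed.
HB.instance Definition _ x :=
  GRing.isLinear.Build K aff aff *:%R (aff_lmul x) (aff_lmul_is_linear x).

Lemma vec_glopE x k (f : cochain vec S k) :
  vec_glop x f = 2 *: post (der (aff_lmul x)) f - gl_act x f.
Proof.
rewrite /vec_glop gl_actE; apply/cochainP => v.
rewrite !(cochainD, cochainN, cochainZ) !postE /= sym_actE.
rewrite (@der_comb _ _ _ (lie (gl_aff x)) (fun y => 2 *: aff_lmul x y) (-1)); last first.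
  move=> y; rewrite lie_gl_aff; congr (_, _).
    rewrite /= addr0 lie_gl scaler_nat; lmod K.
  by rewrite /= add0r; lmod K.
rewrite (@der_comb _ _ (fun y => 2 *: aff_lmul x y) (aff_lmul x) (fun=> 0) 2); last first.
  by move=> y; rewrite addr0.
by rewrite [der (fun=> 0) _]der_null //; lmod K.
Qed.

(** Bracketing with [K^m] multiplies the [gl_m] component on the right, so it commutes with left
    multiplication; the other part of [vec_glop] is the action of [x]. *)
Lemma vec_glop_dif x k (f : cochain vec S k) :
  vec_glop x (dif nrep f) = dif nrep (vec_glop x f).
Proof.
rewrite !vec_glopE linearB linearZ /= -gl_act_dif; congr (_ *: _ - _).
have nE v p : nrep v p = der (lie (vec_aff v)) p by exact: sym_actE.
apply: post_dif => u p; rewrite !nE /=.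
rewrite (@der_comm _ _ (aff_lmul x) (lie (vec_aff u)) \0) => [|y].
  by rewrite (@der_null _ _ \0) // addr0.
rewrite -[RHS]/(aff_lmul x (lie (vec_aff u) y) - lie (vec_aff u) (aff_lmul x y)).
rewrite !lie_vec_aff; congr (_, _); rewrite /= ?mulmx0 ?subr0 //.
by rewrite mulmxN mulmxA subrr.
Qed.

Local Notation ext := (@pull _ _ _ _ aff_snd).
Local Notation res := (@pull _ _ _ _ (@vec_aff K m)).

Lemma res_ext k (f : cochain vec S k) : res (ext f) = f.
Proof. by apply/cochainP. Qed.

Lemma lieder_ext x k (f : cochain vec S k) :
  lieder rho (gl_aff x) (ext f) = ext (gl_act x f).
Proof.
rewrite liederE gl_actE linearB /= (@pull_sub _ _ _ _ _ _ (lie (gl_aff x))).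
  by congr (_ - _); apply/cochainP.
by move=> y; rewrite /aff_snd /= mulmx0 subr0.
Qed.

Lemma res_dif k (F : cochain aff S k) : res (dif rho F) = dif nrep (res F).
Proof.
have := @pull_dif _ _ _ _ _ rho nrep (@vec_aff K m) idfun _ _ k F.
by rewrite !post_id //; apply=> // x y; apply: vec_aff_lie.
Qed.

(** The homotopy formula is applied to the extension [F] of [f] by 0 on [gl_m]. Its differential
    vanishes on [K^m], and contracting it with [gl_aff x] gives the extension of [gl_act x f]. *)
Lemma vec_homotopy k (f : cochain vec S k.+1) : dif nrep f = 0 ->
  2 *: post (der idfun) f = dif nrep (res (euler_hom (ext f)))
  - \sum_p vec_glop (gl_basis p) (gl_act (gl_dual p) f)
  + gl_act 1%:M (gl_act 1%:M f) + (m%:R + 1) *: gl_act 1%:M f.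
Proof.
move=> df; set F := ext f.
have contr_dF x : contr (gl_aff x) (dif rho F) = ext (gl_act x f).
  have F0 : contr (gl_aff x) F = 0.
    by rewrite contr_pull -[X in contr X f]/(0 : vec) contr0l linear0.
  by rewrite contr_difS lieder_ext F0 linear0 subr0.
have dF0 a : contr a (res (dif rho F)) = 0 by rewrite res_dif res_ext df linear0.
have := congr1 (@pull _ _ _ _ (@vec_aff K m) k.+1) (euler_homotopy F).
rewrite linearD linearZ /= res_dif => /esym.
have -> : res (post (der idfun) F) = post (der idfun) f.
  by apply/cochainP.
move=> ->; rewrite -!addrA; congr (_ + _).
rewrite euler_homE !linearD /= linearN !linearZ /= !contr_dF lieder_ext !res_ext.
have -> : res (\sum_a post (der (aff_mu (delta_mx 0 a)))
    (contr (vec_aff (vec_basis K a)) (dif rho F))) = 0.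
  rewrite linear_sum big1 // => a _ /=; apply/cochainP => v.
  rewrite pullE postE.
  by have /cochainP/(_ v) := dF0 (vec_basis K a); rewrite contr_pull pullE => ->; rewrite linear0.
rewrite scaler0 add0r -!addrA; congr (- _ + _).
rewrite linear_sum; apply: eq_bigr => p _ /=.
rewrite contr_dF /glop /vec_glop linearD /=.
rewrite (@pull_sub _ _ _ _ _ _ (mulv (gl_basis p))) ?res_ext //.
by congr (_ + _); apply/cochainP.
Qed.

(** Here [f] is invariant only up to coboundaries [d w]. Since [vec_glop] and [gl_act] commute with
    [d], all correction terms of [vec_homotopy] are coboundaries too. *)
Theorem vec_invariant_coboundary k (f : cochain vec S k.+1) : dif nrep f = 0 ->
  (forall x, coboundary nrep (gl_act x f)) -> coboundary nrep f.
Proof.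
move=> df inv.
have /choice[w wE] : forall x, exists g, gl_act x f = dif nrep g by [].
have ab j (g : cochain vec K^o j) : dif (lieRep_trivial vec K^o) g = 0.
  elim: j g => [|j IH] g; apply: contr_ext => u; rewrite linear0.
    by rewrite contr_dif0 lieder_triv sub_null ?oppr0.
  by rewrite contr_difS lieder_triv sub_null ?oppr0 // IH subr0.
(* The identity matrix acts on the constant part by [-(k + 1)]. The result is also a scalar
   coboundary of an abelian Lie algebra, hence 0. *)
have af : post (@aug K aff) f = 0.
  have : post (@aug K aff) (gl_act 1%:M f) = 0.
    rewrite wE (@post_dif _ _ _ _ nrep (lieRep_trivial vec K^o)) ?ab // => x p.
    exact: aug_rep.
  rewrite gl_actE linearB /= (@post_comp _ _ _ _ _ _ _ \0); last first.
    by move=> p; apply/esym/aug_rep.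
  rewrite post_null // sub0r post_sub (@sub_eq _ _ _ _ idfun) => [|y]; last exact: mul1mx.
  rewrite sub_id => /eqP; rewrite oppr_eq0 -scaler_nat scaler_eq0.
  by rewrite (pcharf0P K).1 // => /eqP.
have := post_euler_inv charK f; rewrite af linear0 subr0 => <-.
have h := vec_homotopy df.
pose g := res (euler_hom (ext f)) - \sum_p vec_glop (gl_basis p) (w (gl_dual p))
  + gl_act 1%:M (w 1%:M) + (m%:R + 1) *: w 1%:M.
exists (post (@euler_inv K aff) (2^-1 *: g)).
rewrite -(@post_dif _ _ _ _ nrep nrep) => [|u p]; last exact: euler_inv_rep.
congr post.
have -> : post (der idfun) f = 2^-1 *: (2 *: post (der idfun) f).
  by rewrite scalerA mulVf ?scale1r // two_neq0.
rewrite h linearZ; congr (_ *: _); rewrite /g !linearD linearN linearZ /=.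
rewrite !wE !gl_act_dif [dif nrep (\sum_p _)]linear_sum.
by congr (_ - _ + _ + _); apply: eq_bigr => p _; rewrite wE vec_glop_dif.
Qed.

Lemma coh_inv_class k (h : coh_inv (@gl_eqv K m) k) : exists z : cocycle nrep k,
  coh_inv_val h = coh_class z /\ forall x, coboundary nrep (gl_act x (cochain_of z)).
Proof.
have [z hz] := coh_classP (coh_inv_val h); exists z; split=> // x.
have /asboolP/(_ x) := coh_inv_valP h; rewrite hz /coh_class coh_act_pi => hx.
have /coh_class_eq : coh_class (cocycle_act (gl_eqv x) z) = coh_class 0.
  by rewrite [RHS]linear0.
rewrite linear0 subr0 (_ : cochain_of _ = gl_act x (cochain_of z)) //.
by apply/val_inj; rewrite /= gl_act_cochain.
Qed.

Theorem coh_inv_trivial k : (1 <= k)%N -> lmod_trivial (coh_inv (@gl_eqv K m) k).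
Proof.
case: k => // k _ h; have [z [hz inv]] := coh_inv_class h.
apply/val_inj; rewrite /= hz -[RHS](linear0 (@coh_class _ _ _ nrep k.+1)).
apply/coh_class_eq; rewrite linear0 subr0.
by apply: vec_invariant_coboundary inv; apply: dif_cochain_of.
Qed.

(** An invariant is a 0-cocycle of [g], so the homotopy formula in degree 0 shows that the Euler
    operator kills it. *)
Lemma aff_invariant (p : S) : (forall u : aff, rho u p = 0) -> p = (aug p)%:A.
Proof.
move=> up; have fA : alt_multilinear (fun _ : 'I_0 -> aff => p) by split=> v [].
pose f : cochain aff S 0 := mk_cochain fA.
have df : dif rho f = 0.
  apply: contr_ext => u; rewrite contr_dif0 liederE sub0c subr0 linear0.
  by apply/cochainP => v; apply: up.
have := euler_homotopy0 f; rewrite df linear0 => /esym/eqP.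
rewrite scaler_eq0 (negbTE (two_neq0 charK)) => /eqP/cochainP/(_ (fun _ => 0)).
rewrite postE => N0; apply/eqP; rewrite -subr_eq0 -(eulerK charK p).
by rewrite [der idfun p]N0 linear0.
Qed.

(** Independent of the representative, as the only coboundary of degree 0 is 0. *)
Definition degree0 (h : coh nrep 0) : K^o := aug (cochain_of (repr h) (fun _ => 0)).

Lemma coboundary0 (z : cocycle nrep 0) : coh_class z = 0 -> cochain_of z = 0.
Proof.
move=> z0; have /coh_class_eq : coh_class z = coh_class 0 by rewrite z0 linear0.
by rewrite linear0 subr0.
Qed.

Lemma degree0_class z : degree0 (coh_class z) = aug (cochain_of z (fun _ => 0)).
Proof.
congr (aug (cochain_val _ _)); apply/eqP; rewrite -subr_eq0 -linearB; apply/eqP.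
by apply: coboundary0; rewrite linearB /= {1}/coh_class reprK subrr.
Qed.

Lemma degree0_linear : linear degree0.
Proof.
move=> a g h; have [y ->] := coh_classP g; have [z ->] := coh_classP h.
by rewrite -linearP !degree0_class -linearP.
Qed.
HB.instance Definition _ := GRing.isLinear.Build K (coh nrep 0) K^o *:%R degree0 degree0_linear.

Theorem coh_inv0 : lmod_iso (coh_inv (@gl_eqv K m) 0) K^o.
Proof.
pose F : {linear coh_inv (@gl_eqv K m) 0 -> K^o} := degree0 \o val.
have cA (c : K^o) : alt_multilinear (fun _ : 'I_0 -> vec => scal aff c) by split=> v [].
have dc c : dif nrep (mk_cochain (cA c)) = 0.
  apply: contr_ext => u; rewrite contr_dif0 liederE sub0c subr0 linear0.
  by apply/cochainP => v; rewrite postE /= /lieRep_res_fun /= /scal sym_actA.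
have inv c : coh_class (cocycle_of (dc c)) \in @coh_inv_pred _ _ _ _ _ (@gl_eqv K m) 0.
  apply/asboolP => x; rewrite /coh_class coh_act_pi -/(coh_class _).
  rewrite -[RHS](linear0 (@coh_class _ _ _ nrep 0)); apply/coh_class_eq.
  rewrite linear0 subr0 /=; apply/cochainP => v; rewrite cochain0.
  have := gl_act_cochain x (mk_cochain (cA c)) => /(congr1 (fun g => g v)) /= <-.
  by rewrite gl_actE sub0c subr0 postE /= /scal sym_actA.
exists F; exists (fun c => CohInv (inv c)) => [h|c]; last first.
  by rewrite /F /= degree0_class; apply: augA.
have [z [hz invz]] := coh_inv_class h; apply/val_inj; rewrite /F /= hz.
apply/coh_class_eq/eqP; rewrite subr_eq0; apply/eqP/cochainP => v.
rewrite degree0_class (ord0_fun v (fun _ => 0)); set p := cochain_of z _.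
(* Invariance under [K^m] is the cocycle condition, and invariance under [gl_m] is that of the
   class; together they give invariance under [g]. *)
rewrite -[LHS]/(scal aff (aug p)); apply/esym/aff_invariant => u.
have zx x : rho (gl_aff x) p = 0.
  have /= := invz x; rewrite gl_actE sub0c subr0 => /cochainP/(_ (fun _ => 0)).
  by rewrite postE.
have zv w : rho (vec_aff w) p = 0.
  have := dif_cochain_of z => /(congr1 (contr w)); rewrite contr_dif0 linear0.
  by rewrite liederE sub0c subr0 => /cochainP/(_ (fun _ => 0)).
rewrite (aff_split u); have := lieRep_linearl rho p 1 (gl_aff u.1) (vec_aff u.2).
by rewrite !scale1r zx zv addr0.
Qed.
End VectorCohomology.

Theorem mainTheorem4 (K : closedFieldType) (charK : [pchar K] =i pred0)
    (m : nat) (m_gt0 : (0 < m)%N) :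
  [/\ lmod_iso (coh_inv (@gl_eqv K m) 0) K^o,
      (forall k : nat, (1 <= k)%N -> lmod_trivial (coh_inv (@gl_eqv K m) k)),
      (forall k : nat, lmod_iso (coh (sym_rep (aff_lie K m)) k)
                                (coh (lieRep_trivial (gl_lie K m) K^o) k)),
      lmod_trivial (coh (sym_rep (aff_lie K m)) 2)
    & infinitesimally_strongly_rigid (aff_lie K m)].
Proof.
have iso k := @coh_sym_aff K m charK k.
have triv2 : lmod_trivial (coh (sym_rep (aff_lie K m)) 2).
  have [f [g fK _]] := iso 2 => h.
  by rewrite -[h]fK (coh_gl2 charK m_gt0 (f h)) -[RHS]fK linear0.
split=> //; first exact: coh_inv0.
exact: coh_inv_trivial.
Qed.
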